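(* Let $\mathcal L$ be a language containing a binary predicate $<$ and let $T$ be a definably complete locally o-minimal $\mathcal L$-theory. Let $\mathcal M=(M,\ldots)$ be a model of $T$, let $A$ be a subset of $M$, and let $X$ be a subset of $M^n$ definable over $A$ (i.e. definable by an $\mathcal L$-formula with parameters from $A$). Then $$\dim X=\operatorname{rk}_T^{\operatorname{discl}}(X/A).$$
   Context: ''Definable'' means definable in the given structure with parameters unless the parameters are specified. Let $\mathcal M=(M,<,\ldots)$ be an expansion of a dense linear order without endpoints; $M$ carries the order topology and $M^n$ the product topology. $M^0$ is a singleton with the trivial topology; a projection $M^n\to M^0$ is the trivial map, and the nonempty open box in $M^0$ is $M^0$ itself. An open interval is a nonempty set $(a,b)=\{x\in M : a<x<b\}$ with $a,b\in M\cup\{\pm\infty\}$. $\mathcal M$ is locally o-minimal if, for every definable subset $X$ of $M$ and every $a\in M$, there exists an open interval $I$ containing $a$ such that $X\cap I$ is a finite union of points and open intervals. $\mathcal M$ is definably complete if every definable subset of $M$ has a supremum and an infimum in $M\cup\{\pm\infty\}$. A complete theory $T$ is a definably complete locally o-minimal theory if every model of $T$ is (an expansion of a dense linear order without endpoints that is) definably complete and locally o-minimal. Dimension: for a nonempty definable subset $X$ of $M^n$, $\dim X$ is the maximal nonnegative integer $d$ such that $\pi(X)$ has nonempty interior for some coordinate projection $\pi:M^n\to M^d$; $\dim\emptyset=-\infty$. Discrete closure: for a definably complete locally o-minimal structure $\mathcal M$ and $A\subseteq M$, $\operatorname{discl}_{\mathcal M}(A)$ is the set of points $x\in M$ for which there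 is an $\mathcal L(A)$-formula $\phi(t)$ in one free variable such that $\phi(\mathcal M)=\{t\in M:\mathcal M\models\phi(t)\}$ contains $x$ and is discrete and closed. The pair $(M,\operatorname{discl}_{\mathcal M})$ is a pregeometry. Rank: let $(S,\operatorname{cl})$ be a pregeometry and $A,B\subseteq S$. $A$ is $\operatorname{cl}$-independent over $B$ if $a\notin\operatorname{cl}((A\setminus\{a\})\cup B)$ for every $a\in A$. A subset $A_0\subseteq A$ is a $\operatorname{cl}$-basis for $A$ over $B$ if $A\subseteq\operatorname{cl}(A_0\cup B)$ and $A_0$ is $\operatorname{cl}$-independent over $B$. All such bases have the same cardinality, denoted $\operatorname{rk}^{\operatorname{cl}}(A/B)$. Let $\mathbb M$ be a monster model of $T$ (a sufficiently saturated and strongly homogeneous model of $T$, with $\mathcal M$ a small elementary substructure of it); its universe is also denoted $\mathbb M$. For a definable set $X\subseteq M^n$, $X^{\mathbb M}\subseteq\mathbb M^n$ is the set defined in $\mathbb M$ by any formula defining $X$ in $\mathcal M$. For $A\subseteq M$ set $$\operatorname{rk}_T^{\operatorname{discl}}(X/A)=\max\{\operatorname{rk}^{\operatorname{discl}_{\mathbb M}}(\{a_1,\ldots,a_n\}/A) : (a_1,\ldots,a_n)\in X^{\mathbb M}\},$$ with the convention that the maximum of the empty set is $-\infty$. *)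

(* Defs.v *)
From HB Require Import structures.
From mathcomp Require Import all_boot all_order all_classical.
From mathcomp Require Import constructive_ereal topology function_spaces.

Set Implicit Arguments.
Unset Strict Implicit.
Unset Printing Implicit Defensive.

Local Open Scope classical_set_scope.
Local Open Scope card_scope.

Record language := Language {
  fsym : Type;
  farity : fsym -> nat;
  rsym : Type;
  rarity : rsym -> nat;
  lt_sym : rsym;
  rarity_lt : rarity lt_sym = 2 }.

Record structure (L : language) := Structure {
  dom :> Type;
  dom_inhabited : inhabited dom;
  fun_interp : forall f : fsym L, ('I_(farity f) -> dom) -> dom;
  rel_interp : forall r : rsym L, ('I_(rarity r) -> dom) -> Prop }.

(* [term L C n] and [formula L C n]: free variables x_0, ..., x_(n-1), and one
   new constant symbol for each element of [C].  So [formula L void n] is the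
   type of L-formulas and, for [A : set M], [formula L A n] (with [A] coerced
   to a type) is the type of L(A)-formulas. *)
Inductive term (L : language) (C : Type) (n : nat) : Type :=
| Var (i : 'I_n)
| Cst (c : C)
| App (f : fsym L) (ts : 'I_(farity f) -> term L C n).

(* [Ex p] binds the variable x_0 of [p] and shifts the other ones. *)
Inductive formula (L : language) (C : Type) : nat -> Type :=
| Equ n (s t : term L C n) : formula L C n
| Rel n (r : rsym L) (ts : 'I_(rarity r) -> term L C n) : formula L C n
| Neg n (p : formula L C n) : formula L C n
| And n (p q : formula L C n) : formula L C n
| Ex n (p : formula L C n.+1) : formula L C n.

Definition sentence (L : language) := formula L void 0.

(* M^n, with the product topology once [M] is given its order topology. *)
Notation pow M n := {ptws 'I_n -> dom M}.

Section Semantics.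
Context {L : language} (M : structure L) {C : Type} (c : C -> M).

Fixpoint eval n (v : 'I_n -> M) (t : term L C n) : M :=
  match t with
  | Var i => v i
  | Cst a => c a
  | App f ts => fun_interp (fun k => eval v (ts k))
  end.

Definition vcons n (x : M) (v : 'I_n -> M) : 'I_n.+1 -> M :=
  fun i => if unlift ord0 i is Some k then v k else x.

Fixpoint sat n (p : formula L C n) : ('I_n -> M) -> Prop :=
  match p with
  | Equ _ s t => fun v => eval v s = eval v t
  | Rel _ r ts => fun v => rel_interp (fun k => eval v (ts k))
  | Neg _ q => fun v => ~ sat q v
  | And _ q r => fun v => sat q v /\ sat r v
  | Ex _ q => fun v => exists x, sat q (vcons x v)
  end.

Definition defset n (p : formula L C n) : set (pow M n) := [set v | sat p v].

Definition defset1 (p : formula L C 1) : set M := [set t | sat p (fun=> t)].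

End Semantics.

Section Theories.
Context {L : language}.
Implicit Types (M N : structure L) (T : set (sentence L)).

(* There is exactly one valuation ['I_0 -> M]. *)
Definition holds M (p : sentence L) :=
  forall v : 'I_0 -> M, sat (of_void M) p v.

Definition models M T := forall p, T p -> holds M p.

Definition complete_theory T :=
  (exists M, models M T) /\
  forall p : sentence L,
    (forall M, models M T -> holds M p) \/
    (forall M, models M T -> holds M (Neg p)).

Definition elementary_on M N (B : set M) (f : M -> N) :=
  forall n (p : formula L void n) (v : 'I_n -> M), (forall i, B (v i)) ->
    (sat (of_void M) p v <-> sat (of_void N) p (f \o v)).

Definition elementary_embedding M N (f : M -> N) := elementary_on [set: M] f.

Definition automorphism M (s : M -> M) :=
  [/\ bijective s,
      forall (f : fsym L) (x : 'I_(farity f) -> M),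
        s (fun_interp x) = fun_interp (s \o x) &
      forall (r : rsym L) (x : 'I_(rarity r) -> M),
        rel_interp (s \o x) <-> rel_interp x].

Definition definable_over M (A : set M) n (X : set (pow M n)) :=
  exists p : formula L A n, X = defset val p.

Definition definable1 M (X : set M) :=
  exists p : formula L M 1, X = defset1 id p.

(* X^N for an elementary embedding [j : M -> N]. *)
Definition extension M N (j : M -> N) n (X : set (pow M n)) : set (pow N n) :=
  [set v | exists2 p : formula L M n, X = defset id p & defset j p v].

End Theories.

(* Below, a cardinal kappa is represented by a type [K] of that cardinality. *)

Definition card_lt {T U : Type} (A : set T) (B : set U) :=
  (A #<= B) /\ ~ (B #<= A).

Section Monster.
Context {L : language} (K : Type) (N : structure L).

Definition saturated :=
  forall (B : set N) (P : set (formula L B 1)), card_lt B [set: K] ->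
    (forall F, finite_set F -> F `<=` P ->
       exists x, forall p, F p -> defset1 val p x) ->
    exists x, forall p, P p -> defset1 val p x.

Definition strongly_homogeneous :=
  forall (B : set N) (f : N -> N), card_lt B [set: K] -> elementary_on B f ->
    exists2 s : N -> N, automorphism s & forall x, B x -> s x = f x.

Definition monster :=
  [/\ infinite_set [set: K], saturated & strongly_homogeneous].

End Monster.

Section Order.
Context {L : language} (M : structure L).

(* [rarity lt_sym = 2], so the argument is the pair (a, b). *)
Definition lt (a b : M) : Prop :=
  @rel_interp L M (lt_sym L) (fun i => if i == 0 :> nat then a else b).

Definition dlo_without_endpoints :=
  [/\ forall a, ~ lt a a,
      forall a b c, lt a b -> lt b c -> lt a c,
      forall a b, [\/ lt a b, a = b | lt b a],
      forall a b, lt a b -> exists2 c, lt a c & lt c b &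
      forall a, (exists b, lt b a) /\ (exists b, lt a b)].

(* The order of M extended to [\bar M], i.e., to the disjoint union of M and
   {-oo, +oo}. *)
Definition elt (a b : \bar M) : Prop :=
  match a, b with
  | EFin x, EFin y => lt x y
  | ENInf, ENInf => False
  | ENInf, _ => True
  | EFin _, EPInf => True
  | _, _ => False
  end.

Definition ele (a b : \bar M) : Prop := elt a b \/ a = b.

Definition itvoo (a b : \bar M) : set M := [set x | elt a x%:E /\ elt x%:E b].

Definition open_interval (I : set M) :=
  I !=set0 /\ exists a b, I = itvoo a b.

Definition is_sup (X : set M) (s : \bar M) :=
  (forall x, X x -> ele x%:E s) /\
  forall u, (forall x, X x -> ele x%:E u) -> ele s u.

Definition is_inf (X : set M) (s : \bar M) :=
  (forall x, X x -> ele s x%:E) /\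
  forall u, (forall x, X x -> ele u x%:E) -> ele u s.

Definition definably_complete :=
  forall X : set M, definable1 X -> (exists s, is_sup X s) /\ exists s, is_inf X s.

Definition locally_ominimal :=
  forall (X : set M) (a : M), definable1 X ->
    exists I, [/\ open_interval I, I a &
      exists F : set (set M),
        [/\ finite_set F,
            forall Y, F Y -> (exists y, Y = [set y]) \/ open_interval Y &
            X `&` I = \bigcup_(Y in F) Y]].

End Order.

HB.instance Definition _ L (M : structure L) := gen_eqMixin (dom M).
HB.instance Definition _ L (M : structure L) := gen_choiceMixin (dom M).
(* The order topology, generated by the open intervals. *)
HB.instance Definition _ L (M : structure L) :=
  isSubBaseTopological.Build (dom M) (@open_interval L M) id.

Definition dclom_theory {L : language} (T : set (sentence L)) :=
  complete_theory T /\
  forall M : structure L, models M T ->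
    [/\ dlo_without_endpoints M, definably_complete M & locally_ominimal M].

(* The maximum of a set of natural numbers, in {-oo} + nat: -oo for the empty
   set; the value +oo is only taken when there is no maximum. *)
Definition max_nat (D : set nat) : \bar nat :=
  xget +oo%E [set s | (D = set0 /\ s = -oo%E) \/
                      exists m, [/\ D m, forall k, D k -> k <= m & s = m%:E]].

Definition coord_proj {L} {M : structure L} n d (f : 'I_d -> 'I_n)
  (x : pow M n) : pow M d := fun i => x (f i).

(* If X is empty then so is the set of [d]s, and the dimension is -oo. *)
Definition dim {L} {M : structure L} n (X : set (pow M n)) : \bar nat :=
  max_nat [set d | exists2 f : 'I_d -> 'I_n, {homo f : i k / i < k} &
                     (coord_proj f @` X)° !=set0].

Section Rank.
Context {S : Type} (cl : set S -> set S).

Definition independent_over (A B : set S) :=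
  forall a, A a -> ~ cl ((A `\ a) `|` B) a.

Definition basis_over (A0 A B : set S) :=
  [/\ A0 `<=` A, A `<=` cl (A0 `|` B) & independent_over A0 B].

(* The common cardinality of the bases of A over B, for A finite. *)
Definition rk (A B : set S) : nat :=
  xget 0 [set k | exists2 A0, basis_over A0 A B & A0 #= `I_k].

End Rank.

Definition discl {L} {M : structure L} (A : set M) : set M :=
  [set x | exists p : formula L A 1,
     [/\ defset1 val p x, defset1 val p `<=` isolated (defset1 val p) &
         closed (defset1 val p)]].

(* rk_T^discl(X / A), computed in the monster model [U] in which M is
   elementarily embedded by [j]. *)
Definition rk_discl {L} {M U : structure L} (j : M -> U) n
    (X : set (pow M n)) (A : set M) : \bar nat :=
  max_nat [set rk discl (range a) (j @` A) | a in extension j X].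

(* Main.v *)
From HB Require Import structures.
Require Import Defs.
From mathcomp Require Import all_boot all_order all_classical finmap.
From mathcomp Require Import constructive_ereal topology function_spaces.

(* A definable subset of M is discrete and closed iff it contains no interval.
   The one-variable theory rests on a single fact: a transitive definable
   relation that holds between each u and the points immediately to its right
   holds between all u < w of some interval. A Ramsey theorem for
   transitive relations follows, and from it: (1) a union of discrete sets
   indexed by a discrete set is discrete; (2) if W(x, .) contains an interval for
   all x in an interval, then so does some W(., y). Now (1) is the transitivity
   of discl, and (2) its exchange property, so discl is a pregeometry.

   In the monster model every interval has points outside the discrete closure
   of a small set, so a box contains an independent tuple; hence dim <= rk.
   Conversely, if an independent tuple (c, b) lies in a definable Y, then c is
   interior to the fibre Y_b. Choosing an interval (e, e') around c in Y_b with
   e, e' generic, b stays independent over e, e', and by induction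
   {v | (e, e') is contained in Y_v} contains a box; so does Y. *)

Set Implicit Arguments.
Unset Strict Implicit.
Unset Printing Implicit Defensive.

Local Open Scope classical_set_scope.
Local Open Scope card_scope.

(** * Substitution and definability *)

Section Substitution.
Context {L : language}.

(** Constants are substituted along with variables. A parameter can thus be renamed, or turned into
    a variable, which makes one definable set a member of a definable family. *)
Fixpoint tsubst C C' n m (s : 'I_n -> term L C' m) (g : C -> term L C' m)
    (t : term L C n) : term L C' m :=
  match t with
  | Var i => s i
  | Cst a => g a
  | App f ts => App (fun k => tsubst s g (ts k))
  end.

Definition tshift C n : term L C n -> term L C n.+1 :=
  tsubst (fun i => Var L C (lift ord0 i)) (fun a => Cst L n.+1 a).

Definition up C n m (s : 'I_n -> term L C m) (i : 'I_n.+1) : term L C m.+1 :=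
  if unlift ord0 i is Some k then tshift (s k) else Var L C ord0.

Fixpoint fsubst C C' n (p : formula L C n) :
    forall m, ('I_n -> term L C' m) -> (C -> term L C' m) -> formula L C' m :=
  match p with
  | Equ _ s t => fun m h g => Equ (tsubst h g s) (tsubst h g t)
  | Rel _ r ts => fun m h g => Rel (fun k => tsubst h g (ts k))
  | Neg _ q => fun m h g => Neg (fsubst q h g)
  | And _ q r => fun m h g => And (fsubst q h g) (fsubst r h g)
  | Ex _ q => fun m h g => Ex (fsubst q (up h) (fun a => tshift (g a)))
  end.

Context (N : structure L).

Lemma eval_tsubst C C' (c : C' -> N) n m (s : 'I_n -> term L C' m)
    (g : C -> term L C' m) (v : 'I_m -> N) (t : term L C n) :
  Defs.eval c v (tsubst s g t) =
  Defs.eval (fun a => Defs.eval c v (g a)) (fun i => Defs.eval c v (s i)) t.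
Proof.
elim: t => //= f ts IH; congr fun_interp; exact/funext.
Qed.

Lemma vcons0 n x (v : 'I_n -> N) : vcons x v ord0 = x.
Proof. by rewrite /vcons unlift_none. Qed.

Lemma vconsS n x (v : 'I_n -> N) i : vcons x v (lift ord0 i) = v i.
Proof. by rewrite /vcons liftK. Qed.

Lemma eval_tshift C (c : C -> N) n x (v : 'I_n -> N) (t : term L C n) :
  Defs.eval c (vcons x v) (tshift t) = Defs.eval c v t.
Proof.
rewrite eval_tsubst /=; congr (Defs.eval _ _ t); apply/funext => i; exact: vconsS.
Qed.

Lemma sat_fsubst C C' (c : C' -> N) n (p : formula L C n) m
    (s : 'I_n -> term L C' m) (g : C -> term L C' m) (v : 'I_m -> N) :
  sat c (fsubst p s g) v <->
  sat (fun a => Defs.eval c v (g a)) p (fun i => Defs.eval c v (s i)).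
Proof.
elim: p m s g v => {n} /=.
- by move=> n t u m s g v; rewrite !eval_tsubst.
- move=> n r ts m s g v.
  suff -> : (fun k => Defs.eval c v (tsubst s g (ts k))) =
    (fun k => Defs.eval (fun a => Defs.eval c v (g a)) (fun i => Defs.eval c v (s i)) (ts k))
    by [].
  by apply/funext => k; rewrite eval_tsubst.
- by move=> n p IH m s g v; rewrite IH.
- by move=> n p IHp q IHq m s g v; rewrite IHp IHq.
- move=> n p IH m s g v.
  have E x : sat c (fsubst p (up s) (fun a => tshift (g a))) (vcons x v) <->
    sat (fun a => Defs.eval c v (g a)) p (vcons x (fun i => Defs.eval c v (s i))).
    rewrite IH.
    have -> : (fun a => Defs.eval c (vcons x v) (tshift (g a))) =
      (fun a => Defs.eval c v (g a)) by apply/funext => a; rewrite eval_tshift.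
    suff -> : (fun i => Defs.eval c (vcons x v) (up s i)) =
      vcons x (fun i => Defs.eval c v (s i)) by [].
    apply/funext => i; rewrite /up {2}/vcons; case: (unlift ord0 i) => [k|].
      by rewrite eval_tshift.
    by rewrite /= vcons0.
  by split=> -[x /E]; exists x.
Qed.

End Substitution.

Section Definability.
Context {L : language} (N : structure L).

(* A context [E] of [esize] variables, built from [N], ['I_d -> N] and [E * N]; a
   formula in [esize] variables defines a predicate on [E]. In [E * N] the new
   variable is x_0, as after going under the quantifier [Ex]. *)
Class env (E : Type) := Env { esize : nat; evars : E -> 'I_esize -> N }.

#[global] Instance env_one : env N := Env (fun x (_ : 'I_1) => x).
#[global] Instance env_tuple d : env ('I_d -> N) := Env (fun v : 'I_d -> N => v).
#[global] Instance env_cons E {e : env E} : env (E * N) :=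
  Env (fun w => vcons w.2 (evars w.1)).

Context {C : Type} (c : C -> N).

(** A property of the predicate rather than of a formula: definability is then derived from the
    shape of the predicate, and no formula has to be written down. *)
Definition definable_in E {e : env E} (P : E -> Prop) :=
  exists p : formula L C esize, forall x, sat c p (evars x) <-> P x.

Definition term_in E {e : env E} (t : E -> N) :=
  exists s : term L C esize, forall x, Defs.eval c (evars x) s = t x.

Section Closure.
Context {E : Type} {e : env E}.
Implicit Types (P Q : E -> Prop) (s t : E -> N).

Lemma df_ext P Q : (forall x, P x <-> Q x) -> definable_in P -> definable_in Q.
Proof. by move=> PQ [p H]; exists p => x; rewrite H PQ. Qed.

Lemma df_not P : definable_in P -> definable_in (fun x => ~ P x).
Proof. by move=> [p H]; exists (Neg p) => x /=; rewrite H. Qed.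

Lemma df_and P Q : definable_in P -> definable_in Q -> definable_in (fun x => P x /\ Q x).
Proof. by move=> [p H] [q H']; exists (And p q) => x /=; rewrite H H'. Qed.

Lemma df_or P Q : definable_in P -> definable_in Q -> definable_in (fun x => P x \/ Q x).
Proof.
move=> dP dQ; apply: (df_ext _ (df_not (df_and (df_not dP) (df_not dQ)))) => x.
by rewrite not_andE !notE.
Qed.

Lemma df_imp P Q : definable_in P -> definable_in Q -> definable_in (fun x => P x -> Q x).
Proof.
move=> dP dQ; apply: (df_ext _ (df_or (df_not dP) dQ)) => x; split.
  by case.
by case: (pselect (P x)); [right; auto|left].
Qed.

End Closure.

Section Quantifiers.
Context {E : Type} {e : env E}.
Implicit Types (P Q : E -> N -> Prop) (s t : E -> N).

Lemma df_ex (Q : E -> N -> Prop) :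
  definable_in (fun w : E * N => Q w.1 w.2) -> definable_in (fun x => exists y, Q x y).
Proof.
move=> [p H]; exists (Ex p) => x /=.
by split=> -[y Hy]; exists y; have := H (x, y) => /= E'; apply/E'.
Qed.

End Quantifiers.

Section Universal.
Context {E : Type} {e : env E}.
Lemma df_all (Q : E -> N -> Prop) :
  definable_in (fun w : E * N => Q w.1 w.2) -> definable_in (fun x => forall y, Q x y).
Proof.
move=> dQ; apply: (df_ext _ (df_not (df_ex (Q := fun x y => ~ Q x y) (df_not dQ)))) => x.
split; first by move=> H y; apply: contrapT => nQ; apply: H; exists y.
by move=> H [y].
Qed.

End Universal.

Section Atoms.
Context {E : Type} {e : env E}.
Implicit Types (s t : E -> N).

Lemma df_ex2 (P Q : E -> N -> Prop) :
  definable_in (fun w : E * N => P w.1 w.2) -> definable_in (fun w : E * N => Q w.1 w.2) ->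
  definable_in (fun x => exists2 y, P x y & Q x y).
Proof.
move=> dP dQ; apply: (df_ext _ (df_ex (Q := fun x y => P x y /\ Q x y) (df_and dP dQ))) => x.
by split=> [[y []]|[y]]; exists y.
Qed.

Lemma df_eq s t : term_in s -> term_in t -> definable_in (fun x => s x = t x).
Proof. by move=> [a H] [b H']; exists (Equ a b) => x /=; rewrite H H'. Qed.

Lemma df_lt s t : term_in s -> term_in t -> definable_in (fun x => lt (s x) (t x)).
Proof.
move=> [a H] [b H'].
exists (Rel (fun k : 'I_(rarity (lt_sym L)) => if k == 0 :> nat then a else b)) => x /=.
rewrite /lt; set f := (X in rel_interp X); set g := (X in _ <-> rel_interp X).
by have -> : f = g by apply/funext => k; rewrite /f /g; case: ifP.
Qed.

Lemma tm_cst a : term_in (fun _ : E => c a).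
Proof. by exists (Cst L _ a). Qed.

Lemma tm_snd : term_in (fun w : E * N => w.2).
Proof. by exists (Var L C (ord0 : 'I_(esize.+1))) => x /=; rewrite vcons0. Qed.

Lemma tm_fst t : term_in t -> term_in (fun w : E * N => t w.1).
Proof.
by move=> [a H]; exists (tshift a) => -[x y] /=; rewrite eval_tshift.
Qed.

Lemma df_comp E' {e' : env E'} (P : E' -> Prop) (h : E -> E') :
  definable_in P -> (forall i, term_in (fun x => evars (h x) i)) -> definable_in (fun x => P (h x)).
Proof.
move=> [p H] /choice[s Hs].
exists (fsubst p s (fun a => Cst L _ a)) => x.
rewrite sat_fsubst /= -H.
by have -> : (fun i => Defs.eval c (evars x) (s i)) = evars (h x)
  by apply/funext => i; rewrite Hs.
Qed.

End Atoms.

Lemma tm_id : term_in (fun x : N => x).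
Proof. by exists (Var L C (ord0 : 'I_1)). Qed.

Lemma tm_proj d (i : 'I_d) : term_in (fun v : 'I_d -> N => v i).
Proof. by exists (Var L C i). Qed.

Lemma tm_evars E {e : env E} i : term_in (fun x : E => evars x i).
Proof. by exists (Var L C i). Qed.

Lemma df_rel1 E {e : env E} (S : N -> Prop) t :
  definable_in S -> term_in t -> definable_in (fun x : E => S (t x)).
Proof. by move=> dS dt; apply: (df_comp dS). Qed.

(** Meant for the projections from a context extended several times onto an earlier one. *)
Definition weakening E {e : env E} E' {e' : env E'} (h : E -> E') :=
  forall t, term_in t -> term_in (fun x => t (h x)).

Lemma weakening_id E {e : env E} : weakening (fun x : E => x).
Proof. by []. Qed.

Lemma weakening_fst E {e : env E} E' {e' : env E'} (h : E -> E' * N) :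
  weakening h -> weakening (fun x => (h x).1).
Proof. by move=> wh t /tm_fst; exact: wh. Qed.

Lemma weakening_tm E {e : env E} E' {e' : env E'} (h : E -> E') t :
  weakening h -> term_in t -> term_in (fun x => t (h x)).
Proof. exact. Qed.

Lemma tm_evars_cons E {e : env E} E' {e' : env E'} (h : E -> E') (t : E -> N) :
  (forall i, term_in (fun x => evars (h x) i)) -> term_in t ->
  forall i, term_in (fun x => evars (h x, t x) i).
Proof.
move=> dh dt i /=; rewrite /vcons; case: (unlift ord0 i) => [k|//].
exact: dh.
Qed.

Lemma df_rel2 E {e : env E} (W : N -> N -> Prop) s t :
  definable_in (fun w : N * N => W w.1 w.2) -> term_in s -> term_in t ->
  definable_in (fun x : E => W (s x) (t x)).
Proof.
move=> dW ds dt; apply: (df_comp (h := fun x => (s x, t x)) dW).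
exact: tm_evars_cons.
Qed.

End Definability.

(** Having nonempty interior, with both ends in the structure, so that the condition is
    first-order. *)
Definition has_itv {L : language} {N : structure L} (S : N -> Prop) :=
  exists a b, lt a b /\ forall x, lt a x -> lt x b -> S x.

Lemma df_has_itv {L : language} {N : structure L} C (c : C -> N) E {e : env N E}
    (Q : E -> N -> Prop) :
  definable_in c (fun w : E * N => Q w.1 w.2) -> definable_in c (fun x => has_itv (Q x)).
Proof.
move=> dQ; rewrite /has_itv.
apply: (df_ex (Q := fun x a => exists b, lt a b /\ forall y, lt a y -> lt y b -> Q x y)).
apply: (df_ex (Q := fun x b => lt x.2 b /\ forall y, lt x.2 y -> lt y b -> Q x.1 y)).
apply: df_and; first by apply: df_lt; [exact: (tm_fst (tm_snd _)) | exact: tm_snd].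
apply: (df_all (Q := fun x y => lt x.1.2 y -> lt y x.2 -> Q x.1.1 y)).
apply: df_imp; first by apply: df_lt; [exact: (tm_fst (tm_fst (tm_snd _))) | exact: tm_snd].
apply: df_imp; first by apply: df_lt; [exact: tm_snd | exact: (tm_fst (tm_snd _))].
apply: (df_comp (h := fun w : E * N * N * N => (w.1.1.1, w.2)) dQ).
apply: tm_evars_cons; last exact: tm_snd.
move=> i; exact: (tm_fst (tm_fst (tm_fst (tm_evars _ i)))).
Qed.

Ltac subtac :=
  lazymatch goal with
  | |- weakening _ (fun w => w) => exact: weakening_id
  | |- weakening _ (fun w => fst (@?h w)) =>
    refine (@weakening_fst _ _ _ _ _ _ _ _ h _); cbv beta; subtac
  end.

Ltac tmtac :=
  lazymatch goal with
  | |- term_in _ (fun w => w) => exact: tm_id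
  | |- term_in _ (fun w => snd (@?h w)) =>
    refine (@weakening_tm _ _ _ _ _ _ _ _ h snd _ (tm_snd _)); cbv beta; subtac
  | |- term_in _ (fun w => fst (@?h w)) =>
    refine (@weakening_tm _ _ _ _ _ _ _ _ h fst _ (tm_fst (tm_id _))); cbv beta; subtac
  | |- term_in _ (fun w => w ?i) => exact: tm_proj
  | |- term_in _ (fun w => fst (@?h w) ?i) =>
    refine (@weakening_tm _ _ _ _ _ _ _ _ h (fun w => fst w i) _ (tm_fst (tm_proj _ i)));
    cbv beta; subtac
  | |- term_in _ _ => first [ exact: tm_cst | exact: (tm_cst id) ]
  end.

Ltac dfstep :=
  lazymatch goal with
  | |- definable_in _ (fun x => ~ @?P x) => refine (@df_not _ _ _ _ _ _ P _)
  | |- definable_in _ (fun x => @?P x /\ @?Q x) => refine (@df_and _ _ _ _ _ _ P Q _ _)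
  | |- definable_in _ (fun x => @?P x \/ @?Q x) => refine (@df_or _ _ _ _ _ _ P Q _ _)
  | |- definable_in _ (fun x => exists2 y, @?P x y & @?Q x y) =>
    refine (@df_ex2 _ _ _ _ _ _ P Q _ _)
  | |- definable_in _ (fun x => has_itv (@?Q x)) => refine (@df_has_itv _ _ _ _ _ _ Q _)
  | |- definable_in _ (fun x => exists y, @?Q x y) => refine (@df_ex _ _ _ _ _ _ Q _)
  | |- definable_in _ (fun x => @?P x -> @?Q x) => refine (@df_imp _ _ _ _ _ _ P Q _ _)
  | |- definable_in _ (fun x => forall y, @?Q x y) => refine (@df_all _ _ _ _ _ _ Q _)
  | |- definable_in _ (fun x => @?s x = @?t x) => refine (@df_eq _ _ _ _ _ _ s t _ _); tmtac
  | |- definable_in _ (fun x => lt (@?s x) (@?t x)) => refine (@df_lt _ _ _ _ _ _ s t _ _); tmtac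
  | H : definable_in ?c (fun w => ?W w.1 w.2) |- definable_in ?c (fun x => ?W (@?s x) (@?t x)) =>
    refine (@df_rel2 _ _ _ _ _ _ W s t H _ _); tmtac
  | H : definable_in ?c ?W |- definable_in ?c (fun x => ?W (@?t x)) =>
    refine (@df_rel1 _ _ _ _ _ _ W t H _); tmtac
  | H : definable_in ?c ?W |- definable_in ?c ?W => exact H
  end.

Ltac dftac := repeat (dfstep; cbv beta).


(** * Definable subsets of the line *)

Section Tame.
Context {L : language} (N : structure L).
Hypothesis dlo : dlo_without_endpoints N.
Hypothesis dc : definably_complete N.
Hypothesis lom : locally_ominimal N.

Local Notation "x <' y" := (lt x y) (at level 70, no associativity).
Implicit Types (a b x y : N) (S : N -> Prop).

Lemma ltirr a : ~ a <' a. Proof. by case: dlo => H _ _ _ _; exact: H. Qed.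
Lemma lttr b a x : a <' b -> b <' x -> a <' x.
Proof. by case: dlo => _ H _ _ _; exact: H. Qed.
Lemma lttot a b : [\/ a <' b, a = b | b <' a].
Proof. by case: dlo => _ _ H _ _; exact: H. Qed.
Lemma ltdense a b : a <' b -> exists2 x, a <' x & x <' b.
Proof. by case: dlo => _ _ _ H _; exact: H. Qed.
Lemma lt_below a : exists b, b <' a.
Proof. by case: dlo => _ _ _ _ /(_ a)[]. Qed.
Lemma lt_above a : exists b, a <' b.
Proof. by case: dlo => _ _ _ _ /(_ a)[]. Qed.

Lemma nltP a b : ~ a <' b <-> b <' a \/ b = a.
Proof.
split; first by case: (lttot a b) => // H _; [right|left].
by move=> [H|->] H'; [apply: (@ltirr a); apply: lttr H' H|exact: ltirr H'].
Qed.

Lemma lt_min a b x : x <' a -> x <' b ->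
  exists t, [/\ x <' t, forall y, y <' t -> y <' a & forall y, y <' t -> y <' b].
Proof.
move=> xa xb; case: (lttot a b) => [ab|->|ba].
- by exists a; split => // y ya; exact: lttr ya ab.
- by exists b.
- by exists b; split => // y ya; exact: lttr ya ba.
Qed.

Lemma lt_max a b x : a <' x -> b <' x ->
  exists t, [/\ t <' x, forall y, t <' y -> a <' y & forall y, t <' y -> b <' y].
Proof.
move=> xa xb; case: (lttot a b) => [ab|->|ba].
- by exists b; split => // y ya; exact: lttr ab ya.
- by exists b.
- by exists a; split => // y ya; exact: lttr ba ya.
Qed.

Lemma has_itv_mono (S S' : N -> Prop) : (forall x, S x -> S' x) -> has_itv S -> has_itv S'.
Proof. by move=> H [a [b [ab Hab]]]; exists a, b; split => // x ax xb; auto. Qed.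

Lemma has_itv_ex S : has_itv S -> exists x, S x.
Proof. by move=> [a [b [/ltdense[x ax xb] H]]]; exists x; exact: H. Qed.

Lemma has_itv_segment a b : a <' b -> has_itv (fun x => a <' x /\ x <' b).
Proof. by move=> ab; exists a, b. Qed.

(* [r] is [lt] for germs on the right of [x] and the reverse order for germs
   on the left. *)
Definition germ (r : N -> N -> Prop) x S :=
  exists t, r x t /\ ((forall y, r x y -> r y t -> S y) \/
                      (forall y, r x y -> r y t -> ~ S y)).

Section Germ.
Variable r : N -> N -> Prop.
Hypothesis r_irr : forall a, ~ r a a.
Hypothesis r_tr : forall b a c, r a b -> r b c -> r a c.
Hypothesis r_tot : forall a b, [\/ r a b, a = b | r b a].
Hypothesis r_up : forall a, exists b, r a b.

Lemma germ_ext x S S' : (forall y, S y <-> S' y) -> germ r x S -> germ r x S'.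
Proof.
move=> E [t [xt [H|H]]]; exists t; split=> //; [left|right] => y xy yt.
  exact/E/H.
by move/E; exact: H.
Qed.

Lemma germ_cst x (P : Prop) : germ r x (fun=> P).
Proof.
have [t xt] := r_up x; exists t; split=> //.
by case: (pselect P) => ?; [left|right].
Qed.

Lemma germ_gt x a : germ r x (r a).
Proof.
case: (r_tot x a) => [xa|->|ax].
- exists a; split => //; right => y _ ya ay; exact: (r_irr (r_tr ya ay)).
- by have [t xt] := r_up a; exists t; split=> //; left.
- have [t xt] := r_up x; exists t; split=> //; left=> y xy _.
  exact: r_tr ax xy.
Qed.

Lemma germ_lt x a : germ r x (r^~ a).
Proof.
have K : (x = a \/ r a x) -> germ r x (r^~ a).
  have [t xt] := r_up x; move=> K; exists t; split => //; right => y xy _ ya.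
  by case: K => [E|ax]; apply: (@r_irr y); apply: r_tr ya _; rewrite -?E//;
   apply: r_tr ax xy.
case: (r_tot x a) => [xa|?|?]; try by apply: K; auto.
by exists a; split => //; left.
Qed.

Lemma germ_not x S : germ r x S -> germ r x (fun y => ~ S y).
Proof.
by move=> [t [xt [H|H]]]; exists t; split=> //; [right => y xy yt; apply; exact: H|left].
Qed.

Lemma germ_or x S S' : germ r x S -> germ r x S' -> germ r x (fun y => S y \/ S' y).
Proof.
move=> [t [xt H]] [t' [xt' H']].
have [s [xs st st']] : exists s, [/\ r x s, forall y, r y s -> r y t &
    forall y, r y s -> r y t'].
  case: (r_tot t t') => [tt'|->|t't]; [exists t|exists t'|exists t']; split => // y yt; exact: r_tr yt _.
exists s; split => //.
case: H => H; first by left => y xy ys; left; apply: H => //; exact: st.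
case: H' => H'; first by left => y xy ys; right; apply: H' => //; exact: st'.
by right=> y xy ys [|]; [apply: H => //; exact: st|apply: H' => //; exact: st'].
Qed.

Lemma germ_and x S S' : germ r x S -> germ r x S' -> germ r x (fun y => S y /\ S' y).
Proof.
move=> /germ_not G /germ_not G'; apply: germ_ext (germ_not (germ_or G G')) => y.
by rewrite not_orE !notE.
Qed.

(** Points and intervals are Boolean combinations of rays. The rays are those of [lt], whichever of
    the two orders [r] is; hence the two hypotheses on them. *)
Lemma germ_finite_union x (F : set (set N)) :
  (forall y a, germ r y (lt a)) -> (forall y a, germ r y (fun z => z <' a)) ->
  finite_set F ->
  (forall Y, F Y -> (exists y, Y = [set y]) \/ open_interval Y) ->
  germ r x (\bigcup_(Y in F) Y).
Proof.
move=> gt_r lt_r /finite_seqP[s ->]; elim: s => [|Y s IH] H.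
  by apply: germ_ext (germ_cst x False) => y; split => //; case.
have gY : germ r x Y.
  case: (H Y (mem_head _ _)) => [[y ->]|[_ [a [b ->]]]].
    apply: germ_ext (germ_and (germ_not (gt_r x y)) (germ_not (lt_r x y))) => z /=.
    split=> [[/nltP[?|//] ?]|->] //; by split; exact: ltirr.
  apply: germ_and.
    by case: a => [a| |] /=; [exact: gt_r| |]; exact: germ_cst.
  by case: b => [b| |] /=; [exact: lt_r| |]; exact: germ_cst.
have gs : germ r x (\bigcup_(Y in [set` s]) Y).
  by apply: IH => Z Zs; apply: H => /=; rewrite inE [_ \in _]Zs orbT.
apply: germ_ext (germ_or gY gs) => y; split.
  case=> [Yy|[Z Zs Zy]]; first by exists Y => //=; rewrite mem_head.
  by exists Z => //=; rewrite inE [_ \in _]Zs orbT.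
move=> [Z /=]; rewrite inE => /orP[/eqP->|Zs] Zy; [by left|right].
by exists Z.
Qed.

End Germ.

Lemma open_interval_near I x : open_interval I -> I x ->
  exists a b, [/\ a <' x, x <' b & forall y, a <' y -> y <' b -> I y].
Proof.
move=> [_ [s [t ->]]] [/= sx xt].
have [a ax Ha] : exists2 a, a <' x & forall y, a <' y -> elt s y%:E.
  case: s sx => [s sx| |_] //=; first by exists s.
  by have [a] := lt_below x; exists a.
have [b xb Hb] : exists2 b, x <' b & forall y, y <' b -> elt y%:E t.
  case: t xt => [t xt|_ |] //=; first by exists t.
  by have [b] := lt_above x; exists b.
by exists a, b; split=> // y ay yb; split; [exact: Ha|exact: Hb].
Qed.

Lemma definable1_df S : definable_in id S -> definable1 [set x | S x].
Proof. by move=> [p H]; exists p; apply/seteqP; split => x /=; rewrite -H. Qed.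

Lemma local_pieces S x : definable_in id S -> exists F a b,
  [/\ finite_set F, forall Y, F Y -> (exists y, Y = [set y]) \/ open_interval Y,
    a <' x, x <' b &
    forall y, a <' y -> y <' b -> S y <-> (\bigcup_(Y in F) Y) y].
Proof.
move=> /definable1_df/(lom x)[I [oI Ix [F [finF HF SI]]]].
have [a [b [ax xb H]]] := open_interval_near oI Ix.
exists F, a, b; split => // y ay yb; rewrite -SI; split=> [Sy|[]//].
by split => //; exact: H.
Qed.

Let gt_irr a : ~ (fun b c => c <' b) a a. Proof. exact: ltirr. Qed.
Let gt_tr b a x : b <' a -> x <' b -> x <' a.
Proof. by move=> ba xb; exact: lttr xb ba. Qed.
Let gt_tot a b : [\/ b <' a, a = b | a <' b].
Proof. by case: (lttot a b); [constructor 3|constructor 2|constructor 1]. Qed.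

(** Near [x] the set is a finite union of points and open intervals, and immediately to the right of
    [x] each of these is everything or nothing. *)
Lemma right_germ S x : definable_in id S -> exists t, x <' t /\
  ((forall y, x <' y -> y <' t -> S y) \/ (forall y, x <' y -> y <' t -> ~ S y)).
Proof.
move=> /(local_pieces x)[F [a [b [finF HF ax xb H]]]].
have [t [xt K]] := germ_finite_union lttr lttot lt_above x
  (germ_gt ltirr lttr lttot lt_above) (germ_lt ltirr lttr lttot lt_above) finF HF.
have [s [xs st sb]] := lt_min xt xb.
exists s; split => //; case: K => K; [left|right] => y xy ys.
  by apply/(H y (lttr ax xy) (sb _ ys))/K => //; exact: st.
by move/(H y (lttr ax xy) (sb _ ys)); apply: K => //; exact: st.
Qed.

Lemma left_germ S x : definable_in id S -> exists t, t <' x /\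
  ((forall y, y <' x -> t <' y -> S y) \/ (forall y, y <' x -> t <' y -> ~ S y)).
Proof.
move=> /(local_pieces x)[F [a [b [finF HF ax xb H]]]].
have [t [xt K]] := germ_finite_union gt_tr gt_tot lt_below x
  (germ_lt gt_irr gt_tr gt_tot lt_below) (germ_gt gt_irr gt_tr gt_tot lt_below) finF HF.
have [s [xs st sb]] := lt_max xt ax.
exists s; split => //; case: K => K; [left|right] => y xy ys.
  by apply/(H y (sb _ ys) (lttr xy xb))/K => //; exact: st.
by move/(H y (sb _ ys) (lttr xy xb)); apply: K => //; exact: st.
Qed.

(** If one of the two germs of [S] at [x] were contained in [S], it would provide an interval. As
    [x] may lie outside [S], this yields closedness as well as discreteness. *)
Lemma isolated_near S x : definable_in id S -> ~ has_itv S -> exists a b, [/\ a <' x, x <' b &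
  forall y, a <' y -> y <' b -> S y -> y = x].
Proof.
move=> dS nS.
have [b [xb [K|Hb]]] := right_germ x dS.
  by case: nS; exists x, b.
have [a [ax [K|Ha]]] := left_germ x dS.
  by case: nS; exists a, x; split => // y ay yx; exact: K.
exists a, b; split => // y ay yb Sy.
by case: (lttot y x) => [yx|//|xy]; [case: (Ha y yx ay)|case: (Hb y xy yb)].
Qed.

(** The bound [a] and the point [y0] exclude the two infinite values of the infimum. *)
Lemma df_inf S a y0 : definable_in id S -> S y0 -> (forall y, S y -> a <' y) ->
  exists s, (forall y, S y -> ~ y <' s) /\
            (forall u, s <' u -> exists2 y, S y & y <' u).
Proof.
move=> /definable1_df/dc[_ [s [lbs gls]]] Sy0 Sa.
have : ele a%:E s by apply: gls => y /Sa; left.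
have : ele s y0%:E by exact: lbs.
case: s lbs gls => [s| |] lbs gls; [|by case|by move=> _ []].
move=> _ _; exists s; split.
  move=> y /lbs[/= sy ys|[->]]; last exact: ltirr.
  exact: ltirr (lttr sy ys).
move=> u su; apply: contrapT => nu.
have : ele u%:E s%:E.
  apply: gls => y Sy; case: (lttot u y) => [|->|yu]; [by left|by right|].
  by case: nu; exists y.
by case=> [/= us|[E]]; [exact: ltirr (lttr us su)|rewrite E in su; exact: ltirr su].
Qed.

(** If the infimum were missing from [S], points of [S] would accumulate at it from the right, and
    its right germ would be an interval inside [S]. *)
Lemma df_min S a y0 : definable_in id S -> ~ has_itv S -> S y0 -> (forall y, S y -> a <' y) ->
  exists m, S m /\ forall y, S y -> ~ y <' m.
Proof.
move=> dS nS Sy0 Sa; have [s [lbs gls]] := df_inf dS Sy0 Sa.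
exists s; split => //; apply: contrapT => nSs.
have [b [c [_ sc H]]] := isolated_near s dS nS.
have [t [st [K|K]]] := right_germ s dS.
  by apply: nS; exists s, t.
have [y Sy yt] := gls t st; apply: (K y _ yt Sy).
case: (lttot s y) => [//|E|/(lbs y Sy)//]; by rewrite E in nSs.
Qed.

(** Immediately to the right of a point of the interval, [S1] holds everywhere or nowhere; in the
    second case [S2] holds everywhere. *)
Lemma has_itv_or S S1 S2 : definable_in id S1 -> has_itv S -> (forall x, S x -> S1 x \/ S2 x) ->
  has_itv (fun x => S x /\ S1 x) \/ has_itv (fun x => S x /\ S2 x).
Proof.
move=> dS1 [a [b [ab Hab]]] H; have [x ax xb] := ltdense ab.
have [t [xt K]] := right_germ x dS1.
have [s [xs st sb]] := lt_min xt xb.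
have HS y : x <' y -> y <' s -> S y.
  by move=> xy /sb; apply: Hab; exact: lttr ax xy.
case: K => K; [left|right]; exists x, s; split => // y xy ys; split; try exact: HS.
  by apply: K => //; exact: st.
have [S1y|//] := H y (HS y xy ys).
by case: (K y xy (st _ ys)).
Qed.

(* If [P u t] failed to hold on intervals of [u], the set [Cs] of points [t]
   not related to any [u] in (x, t) would be discrete; below its minimum each
   [t] has a least [u] in (x, t) with [P u t], and [u] is not in [Cs], so
   transitivity gives a smaller one. *)
Lemma transitive_germ (P : N -> N -> Prop) a b :
  definable_in id (fun w : N * N => P w.1 w.2) -> a <' b ->
  (forall u v w, P u v -> P v w -> P u w) ->
  (forall u, a <' u -> u <' b -> exists t, u <' t /\ forall w, u <' w -> w <' t -> P u w) ->
  exists t, t <' b /\ has_itv (fun u => a <' u /\ u <' t /\ P u t).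
Proof.
move=> dP ab Ptr Pg; apply: contrapT => nhi.
have [x ax xb] := ltdense ab; have [t0 xt0 t0b] := ltdense xb.
pose Cs t := x <' t /\ t <' t0 /\ forall u, x <' u -> u <' t -> ~ P u t.
have dCs : definable_in id Cs by rewrite /Cs; dftac.
have nCs : ~ has_itv Cs.
  move=> [p [q [pq Hpq]]]; have [u pu uq] := ltdense pq.
  have [xu [ut0 _]] := Hpq u pu uq.
  have [t [ut Ht]] := Pg u (lttr ax xu) (lttr ut0 t0b).
  have [s [us st sq]] := lt_min ut uq.
  have [w uw ws] := ltdense us.
  have [_ [_ /(_ u xu uw)]] := Hpq w (lttr pu uw) (sq _ ws).
  by apply; apply: Ht => //; exact: st.
(* [m] is the minimum of [Cs], or [t0] when [Cs] is empty. *)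
have [m [xm mt0 Hm]] : exists m, [/\ x <' m, forall t, t <' m -> t <' t0 &
    forall t, x <' t -> t <' m -> ~ Cs t].
  have [[y Cy]|nC] := pselect (exists y, Cs y); last first.
    by exists t0; split => // t _ _ Ct; apply: nC; exists t.
  have [m [[xm [mt0 Cm]] Hm]] := df_min dCs nCs Cy (fun y => @proj1 _ _).
  exists m; split => // [t tm|t _ tm /Hm//]; exact: lttr tm mt0.
have [t xt tm] := ltdense xm.
pose Su u := x <' u /\ u <' t /\ P u t.
have dSu : definable_in id Su by rewrite /Su; dftac.
have nSu : ~ has_itv Su.
  move=> H; apply: nhi; exists t; split; first exact: lttr (mt0 _ tm) t0b.
  by apply: has_itv_mono H => u [xu [ut Put]]; split => //; exact: lttr ax xu.
have [u0 Su0] : exists u, Su u.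
  apply: contrapT => nS; apply: (Hm t xt tm); do 2! split => //; first exact: mt0.
  by move=> u xu ut Put; apply: nS; exists u.
have [u [[xu [ut Put]] Hu]] := df_min dSu nSu Su0 (fun y => @proj1 _ _).
apply: (Hm u xu (lttr ut tm)); split => //; split; first exact: mt0 (lttr ut tm).
move=> u' xu' u'u Pu'u; apply: (Hu u') => //; split => //; split.
  exact: lttr u'u ut.
exact: Ptr Pu'u Put.
Qed.

(** Apply [transitive_germ] to the relation [P] below: one [t] then serves a whole interval of
    points [u] to its left, and any [w] of this interval lies in (u, t]. *)
Lemma transitive_homogeneous (R : N -> N -> Prop) a b :
  definable_in id (fun w : N * N => R w.1 w.2) -> a <' b ->
  (forall u v w, R u v -> R v w -> R u w) ->
  (forall u, a <' u -> u <' b -> exists t, u <' t /\ forall w, u <' w -> w <' t -> R u w) ->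
  exists a' b', [/\ a' <' b', forall x, a' <' x -> x <' b' -> a <' x /\ x <' b &
     forall u w, a' <' u -> u <' w -> w <' b' -> R u w].
Proof.
move=> dR ab Rtr Rg.
(* The end [t] is included to make [P] transitive: [R u v] links [u] to the points beyond [v]. *)
pose P u t := u <' t /\ forall w, u <' w -> w <' t \/ w = t -> R u w.
have dP : definable_in id (fun w : N * N => P w.1 w.2) by rewrite /P; dftac.
have Ptr u v w : P u v -> P v w -> P u w.
  move=> [uv Puv] [vw Pvw]; split=> [|z uz zw]; first exact: lttr uv vw.
  case: (lttot z v) => [zv|zv|vz]; [by apply: Puv; auto|by apply: Puv; auto|].
  by apply: Rtr (Pvw _ vz zw); apply: Puv => //; right.
have Pg u : a <' u -> u <' b -> exists t, u <' t /\ forall w, u <' w -> w <' t -> P u w.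
  move=> au ub; have [t [ut Ht]] := Rg u au ub; exists t; split => // w uw wt.
  by split => // z uz [zw|->]; apply: Ht => //; exact: lttr zw wt.
have [t [tb [a' [b' [ab' H]]]]] := transitive_germ dP ab Ptr Pg.
exists a', b'; split => //.
  by move=> x ax xb; have [ax' [xt _]] := H x ax xb; split => //; exact: lttr xt tb.
move=> u w au uw wb.
have [_ [_ [_ Put]]] := H u au (lttr uw wb).
have [_ [wt _]] := H w (lttr au uw) wb.
by apply: Put; auto.
Qed.

(** The right germ of [R1 x] puts each [x] in [G R1] or in [G R2]. One of these contains an
    interval, and there [transitive_homogeneous] applies. *)
Lemma ramsey_transitive (R1 R2 : N -> N -> Prop) a b :
  definable_in id (fun w : N * N => R1 w.1 w.2) -> definable_in id (fun w : N * N => R2 w.1 w.2) ->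
  (forall u v w, R1 u v -> R1 v w -> R1 u w) ->
  (forall u v w, R2 u v -> R2 v w -> R2 u w) ->
  (forall u w, R1 u w \/ R2 u w) -> a <' b ->
  exists a' b', [/\ a' <' b', forall x, a' <' x -> x <' b' -> a <' x /\ x <' b &
     (forall u w, a' <' u -> u <' w -> w <' b' -> R1 u w) \/
     (forall u w, a' <' u -> u <' w -> w <' b' -> R2 u w)].
Proof.
move=> dR1 dR2 tr1 tr2 tot ab.
pose G (R : N -> N -> Prop) u := exists t, u <' t /\ forall w, u <' w -> w <' t -> R u w.
have dG : definable_in id (G R1) by rewrite /G; dftac.
have key (R : N -> N -> Prop) :
    definable_in id (fun w : N * N => R w.1 w.2) -> (forall u v w, R u v -> R v w -> R u w) ->
    has_itv (fun x => (a <' x /\ x <' b) /\ G R x) ->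
    exists a' b', [/\ a' <' b', forall x, a' <' x -> x <' b' -> a <' x /\ x <' b &
       forall u w, a' <' u -> u <' w -> w <' b' -> R u w].
  move=> dR Rtr [p [q [pq Hpq]]].
  have [u pu uq|a' [b' [ab' H1 H2]]] := transitive_homogeneous dR pq Rtr.
    by have [] := Hpq u pu uq.
  exists a', b'; split => // x ax xb; have [px xq] := H1 x ax xb.
  by have [] := Hpq x px xq.
have [x _|H|H] := has_itv_or (S2 := G R2) dG (has_itv_segment ab).
- have dR1x : definable_in id (R1 x) by apply: df_rel2 dR1 (tm_cst id x) (tm_id _).
  have [t [xt [K|K]]] := right_germ x dR1x; [left|right]; exists t; split => // w xw wt.
  by have [/(K w xw wt)|] := tot x w.
- have [a' [b' [? ? ?]]] := key R1 dR1 tr1 H; exists a', b'; split => //; by left.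
- have [a' [b' [? ? ?]]] := key R2 dR2 tr2 H; exists a', b'; split => //; by right.
Qed.

(** Inclusion of fibres and reverse inclusion are the two transitive relations. *)
Lemma ramsey_chain (T : N -> N -> Prop) a b :
  definable_in id (fun w : N * N => T w.1 w.2) ->
  (forall u w, (forall y, T u y -> T w y) \/ (forall y, T w y -> T u y)) -> a <' b ->
  exists a' b', [/\ a' <' b', forall x, a' <' x -> x <' b' -> a <' x /\ x <' b &
     (forall u w, a' <' u -> u <' w -> w <' b' -> forall y, T u y -> T w y) \/
     (forall u w, a' <' u -> u <' w -> w <' b' -> forall y, T w y -> T u y)].
Proof.
move=> dT ch ab.
apply: (@ramsey_transitive (fun u w => forall y, T u y -> T w y)
                           (fun u w => forall y, T w y -> T u y)) => //; try by dftac.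
- by move=> u v w H1 H2 y /H1/H2.
- by move=> u v w H1 H2 y /H2/H1.
Qed.

(** The sets of indices [y] with [T y x] also form a chain as [x] varies. Where they are monotone in
    [x], an index that serves one [x] serves all those on one side of it. *)
Lemma has_itv_chain_union (T : N -> N -> Prop) :
  definable_in id (fun w : N * N => T w.1 w.2) ->
  (forall u w, (forall x, T u x -> T w x) \/ (forall x, T w x -> T u x)) ->
  has_itv (fun x => exists y, T y x) -> exists y, has_itv (T y).
Proof.
move=> dT ch [a [b [ab Hab]]].
have dT' : definable_in id (fun w : N * N => (fun x y => T y x) w.1 w.2) by dftac.
have ch' u w : (forall y, T y u -> T y w) \/ (forall y, T y w -> T y u).
  have [?|nuw] := pselect (forall y, T y u -> T y w); [by left|right => y Tyw].
  apply: contrapT => nTyu; apply: nuw => z Tzu.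
  by have [H|H] := ch y z; [exact: H|case: nTyu; exact: H].
have [a' [b' [ab' sub [H|H]]]] := ramsey_chain dT' ch' ab.
  have [u au ub] := ltdense ab'; have [au' ub'] := sub u au ub.
  have [y Tyu] := Hab u au' ub'; exists y, u, b'; split => // x ux xb; exact: (H u x au ux xb).
have [w aw wb] := ltdense ab'; have [aw' wb'] := sub w aw wb.
have [y Tyw] := Hab w aw' wb'; exists y, a', w; split => // x ax xw; exact: (H x w ax xw wb).
Qed.

(* Two uses of [has_itv_chain_union] confine [D] to a segment [a, b]; at the infimum
   [s] of the [y] for which the union over [D] in [a, y] has interior, only the
   single set [F s] is added. *)
Lemma discrete_union (D : N -> Prop) (F : N -> N -> Prop) :
  definable_in id D -> definable_in id (fun w : N * N => F w.1 w.2) -> ~ has_itv D ->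
  (forall y, D y -> ~ has_itv (F y)) -> ~ has_itv (fun x => exists y, D y /\ F y x).
Proof.
move=> dD dF nD nF hU.
pose T y x := exists y', D y' /\ ~ y <' y' /\ F y' x.
have dT : definable_in id (fun w : N * N => T w.1 w.2) by rewrite /T; dftac.
have [||b hb] := has_itv_chain_union dT.
- move=> u w; case: (lttot u w) => [uw|->|wu]; [left|left|right] => // x [y [Dy [H Fy]]];
   exists y; split => //; split => // ?; apply: H.
    exact: lttr uw _.
  exact: lttr wu _.
- apply: has_itv_mono hU => x [y [Dy Fy]]; exists y, y; split => //; split => //; exact: ltirr.
pose S a y x := exists y', D y' /\ ~ y' <' a /\ ~ y <' y' /\ F y' x.
have dS y : definable_in id (fun w : N * N => S w.1 y w.2) by rewrite /S; dftac.
have dS' a : definable_in id (fun w : N * N => S a w.1 w.2) by rewrite /S; dftac.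
have [||a ha] := @has_itv_chain_union (fun a => S a b) (dS b).
- move=> u w; case: (lttot u w) => [uw|->|wu]; [right|right|left] => // x [y [Dy [H H']]];
   exists y; split => //; split => // ?; apply: H.
    by apply: lttr uw.
  by apply: lttr wu.
- apply: has_itv_mono hb => x [y [Dy [H Fy]]]; exists y, y; split => //; split => //; exact: ltirr.
pose E y := has_itv (S a y).
have dE : definable_in id E.
  by apply: df_has_itv; exact: dS'.
have [a' a'a] := lt_below a.
have Ea y : E y -> a' <' y.
  move=> [p [q [pq Hpq]]]; have [x px xq] := ltdense pq.
  have [z [_ [/nltP az [/nltP zy _]]]] := Hpq x px xq.
  have: a' <' z by case: az => [az|<-//]; exact: lttr a'a az.
  by case: zy => [zy a'z|->//]; exact: lttr a'z zy.
have [s [lbs gls]] := df_inf dE ha Ea.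
have [p [q [ps sq Hpq]]] := isolated_near s dD nD.
have [y1 py1 y1s] := ltdense ps.
have [y2 Ey2 y2q] := gls q sq.
have dSy1 : definable_in id (S a y1) by apply: df_rel2 (dS' a) (tm_cst id y1) (tm_id _).
(* The only index between [y1] and [y2] is [s], so the union up to [y2] is covered by the union up
   to [y1] and [F s]. The former contains no interval because [y1] is below the infimum [s] of [E],
   the latter by hypothesis. *)
have [x [y [Dy [ay [yy2 Fy]]]]|H|H] := has_itv_or (S2 := fun x => D s /\ F s x) dSy1 Ey2.
- case: (lttot y1 y) => [y1y|y1y|yy1]; last 2 first.
  + by left; exists y; do 3! split => //; rewrite y1y; exact: ltirr.
  + by left; exists y; do 3! split => //; move/(lttr yy1); exact: ltirr.
  + right; have <- // : y = s.
    apply: Hpq => //; first exact: lttr py1 y1y.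
    by move/nltP: yy2 => [yy2|->//]; exact: lttr yy2 y2q.
- by apply: (lbs y1) => //; apply: has_itv_mono H => x [].
- have [x [_ [Ds _]]] := has_itv_ex H.
  by apply: (nF s Ds); apply: has_itv_mono H => y [_ []].
Qed.

(* For [x] in an interval, [V x] is the first component, to the right of some
   fixed [p], of the interior of [W x]; it starts at the [s] with [l x s]. Its
   lower and upper cuts [Lo x] and [Up x] vary monotonically on a subinterval, so that a point common to two components is
   common to all those in between. If there is none, the components are disjoint,
   their left ends form a discrete set, and [x] is determined by the left end. *)
Lemma has_itv_exchange (W : N -> N -> Prop) :
  definable_in id (fun w : N * N => W w.1 w.2) ->
  has_itv (fun x => has_itv (W x)) -> exists y, has_itv (W^~ y).
Proof.
move=> dW hW.
(* The sets [T p] form a chain, so a single [p] serves an interval of points [x]. It bounds the sets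
   [O x] from below, as [df_inf] requires. *)
pose T p x := has_itv (fun y => p <' y /\ W x y).
have dT : definable_in id (fun w : N * N => T w.1 w.2) by rewrite /T; dftac.
have [||p [a [b [ab Hab]]]] := has_itv_chain_union dT.
- move=> u w; case: (lttot u w) => [uw|->|wu]; [right|right|left] => // x;
    apply: has_itv_mono => y [uy Wxy]; split => //; exact: lttr uy.
- apply: has_itv_mono hW => x [p [q [pq Hpq]]]; exists p, p, q; split => // y py yq; auto.
apply: contrapT => nW.
(* interior of the part of [W x] above [p] *)
pose O x y := exists c d, c <' y /\ y <' d /\ forall z, c <' z -> z <' d -> p <' z /\ W x z.
have dO : definable_in id (fun w : N * N => O w.1 w.2) by rewrite /O; dftac.
have Op x y : O x y -> p <' y by move=> [c [d [cy [yd H]]]]; have [] := H y cy yd.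
have OW x y : O x y -> W x y by move=> [c [d [cy [yd H]]]]; have [] := H y cy yd.
have O_open x y : O x y -> exists c d, [/\ c <' y, y <' d & forall z, c <' z -> z <' d -> O x z].
  by move=> [c [d [cy [yd H]]]]; exists c, d; split => // z cz zd; exists c, d.
have dOx x : definable_in id (O x) by apply: df_rel2 dO (tm_cst id x) (tm_id _).
pose Lo x y := forall z, O x z -> y <' z.
(* At or before [y] there is a gap of [O x] that is not below the whole of [O x]: the first
   component has ended. *)
pose Up x y := exists z, ~ y <' z /\ ~ Lo x z /\ ~ O x z.
have dLo : definable_in id (fun w : N * N => Lo w.1 w.2) by rewrite /Lo; dftac.
have dUp : definable_in id (fun w : N * N => Up w.1 w.2) by rewrite /Up; dftac.
pose V x y := ~ Lo x y /\ ~ Up x y.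
have VW x y : V x y -> W x y.
  move=> [nLo nUp]; apply: OW; apply: contrapT => nO; apply: nUp; exists y.
  by split => //; exact: ltirr.
pose l x s := ~ O x s /\ Lo x s /\ exists t, s <' t /\ forall y, s <' y -> y <' t -> O x y.
have dl : definable_in id (fun w : N * N => l w.1 w.2) by rewrite /l; dftac.
have lV x s : l x s -> exists2 t, s <' t & forall y, s <' y -> y <' t -> V x y.
  move=> [nOs [Los [t [st Ht]]]]; exists t => // y sy yt; split.
    move=> Loy; exact: ltirr (Loy y (Ht y sy yt)).
  move=> [z [/nltP zy [nLoz nOz]]].
  case: (lttot s z) => [sz|sz|zs].
  - by apply: nOz; apply: Ht => //; case: zy => [zy|->//]; exact: lttr zy yt.
  - by apply: nLoz; rewrite -sz.
  - by apply: nLoz => w Ow; apply: lttr zs (Los w Ow).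
have l_ex x : a <' x -> x <' b -> exists s, l x s.
  move=> ax xb; have [c [d [cd Hcd]]] := Hab x ax xb.
  have [y cy yd] := ltdense cd.
  have Oy : O x y by exists c, d.
  have [s [lbs gls]] := df_inf (dOx x) Oy (Op x).
  have nOs : ~ O x s.
    move=> /O_open[u [v [us sv H]]]; have [z uz zs] := ltdense us.
    by apply: (lbs z) => //; apply: H => //; exact: lttr zs sv.
  have Los : Lo x s.
    by move=> z Oz; case: (lttot s z) => [//|E|/(lbs z Oz)//]; rewrite E in nOs.
  exists s; split => //; split => //.
  have [t [st [K|K]]] := right_germ s (dOx x); exists t; split => // z sz zt.
  have [w Ow wt] := gls t st; case: (K w) => //; exact: Los.
have l_uniq x s s' : l x s -> l x s' -> s = s'.
  have K u v : l x u -> l x v -> ~ u <' v.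
    move=> [_ [_ [t [ut Ht]]]] [_ [Lov _]] uv.
    have [y [uy yt yv]] : exists y, [/\ u <' y, y <' t & y <' v].
      have [r [ur rt rv]] := lt_min ut uv; have [y uy yr] := ltdense ur.
      by exists y; split; auto.
    exact: ltirr (lttr yv (Lov y (Ht y uy yt))).
  by move=> ls ls'; case: (lttot s s') => // H; [case: (K s s')|case: (K s' s)].
(* The sets [Lo x] are initial segments and the sets [Up x] final segments, so each family is a
   chain. *)
have LoC u w : (forall y, Lo u y -> Lo w y) \/ (forall y, Lo w y -> Lo u y).
  have [?|n] := pselect (forall y, Lo u y -> Lo w y); [by left|right => y Loy z Oz].
  apply: contrapT => nyz; apply: n => v Lov z' Oz'.
  have vz := Lov z Oz; apply: lttr (Loy z' Oz').
  by move/nltP: nyz => [zy|<-//]; exact: lttr vz zy.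
have UpC u w : (forall y, Up u y -> Up w y) \/ (forall y, Up w y -> Up u y).
  have [?|n] := pselect (forall y, Up u y -> Up w y); [by left|right => y Upy].
  apply: contrapT => nUp; apply: n => z [z' [zz' H]].
  have [y' [yy' H']] := Upy; exists y'; split => // zy'.
  apply: nUp; exists z'; split => // yz'; apply: yy'.
  by apply: lttr yz' _; move/nltP: zz' => [z'z|->//]; exact: lttr z'z zy'.
have [a1 [b1 [ab1 sub1 mLo]]] := ramsey_chain dLo LoC ab.
have [a2 [b2 [ab2 sub2 mUp]]] := ramsey_chain dUp UpC ab1.
have inJ x : a2 <' x -> x <' b2 -> a <' x /\ x <' b.
  by move=> ax xb; have [? ?] := sub2 x ax xb; exact: sub1.
have btw u v w y : a2 <' u -> u <' v -> v <' w -> w <' b2 -> V u y -> V w y -> V v y.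
  move=> au uv vw wb [nLou nUpu] [nLow nUpw].
  have [a1u _] := sub2 u au (lttr uv (lttr vw wb)).
  have [_ wb1] := sub2 w (lttr au (lttr uv vw)) wb.
  split.
    by case: mLo => H K; [apply: nLow|apply: nLou]; apply: H K => //; exact: lttr vw wb1 || exact: lttr a1u uv.
  by case: mUp => H K; [apply: nUpw|apply: nUpu]; apply: H K => //; exact: lttr vw wb || exact: lttr au uv.
have disj u w y : a2 <' u -> u <' w -> w <' b2 -> V u y -> ~ V w y.
  move=> au uw wb Vu Vw; apply: nW; exists y, u, w; split => // v uv vw.
  apply: VW; exact: btw Vu Vw.
have inj u w s : a2 <' u -> u <' b2 -> a2 <' w -> w <' b2 ->
    (exists t, [/\ s <' t, forall y, s <' y -> y <' t -> V u y &
                   forall y, s <' y -> y <' t -> V w y]) -> u = w.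
  move=> au ub aw wb [t [st Hu Hw]]; have [y sy yt] := ltdense st.
  by case: (lttot u w) => // H; [case: (disj u w y)|case: (disj w u y)] => //; auto.
pose D s := exists u, a2 <' u /\ u <' b2 /\ l u s.
pose F s u := a2 <' u /\ u <' b2 /\ l u s.
have dD : definable_in id D by rewrite /D; dftac.
have dF : definable_in id (fun w : N * N => F w.1 w.2) by rewrite /F; dftac.
apply: (discrete_union dD dF).
(* If left ends filled an interval, some left end [s'] would lie in [V u] for a [u] with left end
   [s] below [s']. The component starting at [s'] would meet [V u], hence belong to [u] as well,
   which has one left end only. *)
- move=> [c [d [cd Hcd]]]; have [s cs sd] := ltdense cd.
  have [u [au [ub lu]]] := Hcd s cs sd; have [t st Ht] := lV _ _ lu.
  have [r [sr rt rd]] := lt_min st sd; have [s' ss' s'r] := ltdense sr.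
  have [w [aw [wb lw]]] := Hcd s' (lttr cs ss') (rd _ s'r).
  have [t' st' Ht'] := lV _ _ lw.
  have E : u = w.
    apply: (inj u w s') => //.
    have [q [s'q qr qt']] := lt_min s'r st'; exists q; split => // y sy yq.
      by apply: Ht; [exact: lttr ss' sy|apply/rt/qr].
    by apply: Ht' => //; exact: qt'.
  rewrite -E in lw; rewrite (l_uniq _ _ _ lu lw) in ss'; exact: ltirr ss'.
(* Two components with the same left end overlap, so they belong to the same point. *)
- move=> s _ [c [d [cd Hcd]]].
  have [u cu ud] := ltdense cd; have [w uw wd] := ltdense ud.
  have [au [ub lu]] := Hcd u cu ud; have [aw [wb lw]] := Hcd w (lttr cu uw) wd.
  suff E : u = w by rewrite E in uw; exact: ltirr uw.
  have [t st Ht] := lV _ _ lu; have [t' st' Ht'] := lV _ _ lw.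
  have [q [sq qt qt']] := lt_min st st'.
  by apply: (inj u w s) => //; exists q; split => // y sy yq; [apply/Ht/qt|apply/Ht'/qt'].
- exists a2, b2; split => // x ax xb; have [ax' xb'] := inJ x ax xb.
  by have [s ls] := l_ex x ax' xb'; exists s; split => //; exists x.
Qed.
End Tame.

(** * The order topology and the discrete closure *)

Section Topology.
Context {L : language} (N : structure L).
Hypothesis dlo : dlo_without_endpoints N.
Local Notation "x <' y" := (lt x y) (at level 70, no associativity).

(** Basic open sets are finite intersections of open intervals, and finitely many intervals around
    [x] have an interval around [x] in common. *)
Lemma nbhs_itv (x : N) (A : set N) : nbhs x A <->
  exists a b, [/\ a <' x, x <' b & forall y, a <' y -> y <' b -> A y].
Proof.
split.
  rewrite nbhsE => -[B [oB Bx] sBA].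
  have [D' sD' UB] := oB; move: Bx; rewrite -UB => -[E DE Ex].
  have [F0 sF0 IE0] := sD' _ DE; pose F : {fset set N} := F0.
  have IE : \bigcap_(i in [set` F]) i = E by exact: IE0.
  have {}sBA y : E y -> A y by move=> Ey; apply: sBA; rewrite -UB; exists E.
  have {}Ex Y : Y \in F -> Y x by move=> YF; move: Ex; rewrite -IE; apply.
  have {}sBA y : (forall Y, Y \in F -> Y y) -> A y.
    by move=> H; apply: sBA; rewrite -IE => Y; exact: H.
  have sF Y : Y \in F -> open_interval Y by move=> YF; exact: set_mem (sF0 Y YF).
  have : forall s : seq (set N), (forall Y, Y \in s -> open_interval Y /\ Y x) ->
      exists a b, [/\ a <' x, x <' b & forall Y y, Y \in s -> a <' y -> y <' b -> Y y].
    elim=> [_|Y s IH H].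
      by have [a ax] := lt_below dlo x; have [b xb] := lt_above dlo x; exists a, b.
    have [Z Zs|a [b [ax xb Hab]]] := IH; first by apply: H; rewrite inE Zs orbT.
    have [oY Yx] := H Y (mem_head _ _).
    have [c [d [cx xd Hcd]]] := open_interval_near dlo oY Yx.
    have [e [ex ea ec]] := lt_max dlo ax cx; have [f [xf fb fd]] := lt_min dlo xb xd.
    exists e, f; split => // Z y; rewrite inE => /orP[/eqP->|Zs] ey yf.
      by apply: Hcd; [exact: ec|exact: fd].
    by apply: Hab => //; [exact: ea|exact: fb].
  move=> /(_ F)[Y YF|a [b [ax xb H]]]; first by split; [exact: sF|exact: Ex].
  by exists a, b; split => // y ay yb; apply: sBA => Y YF; exact: H.
move=> [a [b [ax xb H]]]; rewrite nbhsE; exists [set y | a <' y /\ y <' b].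
  split; last by [].
  exists [set [set y | a <' y /\ y <' b]]; last by rewrite bigcup_set1.
  move=> _ ->; apply: (@finI_from1 _ _ (@open_interval L N) id).
  by split; [exists x|exists a%:E, b%:E].
by move=> y [ay yb]; exact: H.
Qed.

Definition is_box d (u w : 'I_d -> N) (Y : ('I_d -> N) -> Prop) :=
  (forall i, u i <' w i) /\
  forall v, (forall i, u i <' v i /\ v i <' w i) -> Y v.

Lemma interior_box d (Y : set (pow N d)) :
  Y° !=set0 <-> exists u w : 'I_d -> N, is_box u w Y.
Proof.
split.
  move=> [x]; rewrite /interior => Yx.
  (* The filter of sets containing a box around [x]. It converges to [x] coordinate by coordinate,
     hence in the product topology, so it contains every neighbourhood of [x]. *)
  pose F : set_system (pow N d) := [set A | exists u w : 'I_d -> N,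
    (forall i, u i <' x i /\ x i <' w i) /\
    forall v : 'I_d -> N, (forall i, u i <' v i /\ v i <' w i) -> A v].
  have FF : Filter F.
    split.
    - have [u Hu] := choice (fun i => lt_below dlo (x i)).
      have [w Hw] := choice (fun i => lt_above dlo (x i)).
      by exists u, w; split.
    - move=> A B [u [w [xuw HA]]] [u' [w' [xuw' HB]]].
      have [s Hs] := choice (fun i => lt_max dlo (xuw i).1 (xuw' i).1).
      have [t Ht] := choice (fun i => lt_min dlo (xuw i).2 (xuw' i).2).
      exists s, t; split => [i|v Hv]; first by have [? _ _] := Hs i; have [? _ _] := Ht i.
      by split; [apply: HA|apply: HB] => i; have [sv vt] := Hv i;
        have [_ H1 H2] := Hs i; have [_ H3 H4] := Ht i; split; auto.
    - by move=> A B sAB [u [w [xuw HA]]]; exists u, w; split => // v /HA/sAB.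
  have : F --> x.
    apply/cvg_sup => i A; rewrite nbhsE => -[_ [[V oV <-] Vx] sVA].
    have /nbhs_itv[a [b [ax xb Hab]]] : nbhs (x i) V by exact: open_nbhs_nbhs.
    have [u Hu] := choice (fun i => lt_below dlo (x i)).
    have [w Hw] := choice (fun i => lt_above dlo (x i)).
    exists (fun k => if k == i then a else u k), (fun k => if k == i then b else w k).
    split=> [k|v Hv]; first by case: eqP => [->|_].
    by apply: sVA; have := Hv i; rewrite eqxx => -[av vb]; exact: Hab.
  move=> /(_ Y Yx)[u [w [xuw HY]]]; exists u, w; split => // i.
  by have [ux xw] := xuw i; exact: (lttr dlo ux xw).
move=> [u [w [uw H]]].
have /choice[x Hx] : forall i, exists y, u i <' y /\ y <' w i.
  by move=> i; have [y uy yw] := ltdense dlo (uw i); exists y.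
exists (x : pow N d); rewrite /interior.
pose P i : set (pow N d) := [set v | u i <' v i /\ v i <' w i].
have nP i : nbhs (x : pow N d) (P i).
  apply: (@proj_continuous 'I_d (fun=> N : topologicalType) i (x : pow N d)
           [set y | u i <' y /\ y <' w i]).
  by apply/nbhs_itv; exists (u i), (w i); have [? ?] := Hx i.
apply: filterS (filter_forall (f := P) (F := nbhs (x : pow N d)) _ nP) => v Hv.
exact: H.
Qed.
End Topology.

(** * Change of parameters *)

Section ParameterSets.
Context {L : language} (N : structure L).

Lemma df_map C C' (c : C -> N) (c' : C' -> N) (g : C -> C') E {e : env N E}
    (P : E -> Prop) :
  (forall a, c' (g a) = c a) -> definable_in c P -> definable_in c' P.
Proof.
move=> cg [p H]; exists (fsubst p (fun i => Var L C' i) (fun a => Cst L _ (g a))) => x.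
rewrite sat_fsubst /= -H.
by have -> : (fun a => c' (g a)) = c by apply/funext.
Qed.

Lemma df_id C (c : C -> N) E {e : env N E} (P : E -> Prop) : definable_in c P -> definable_in id P.
Proof. exact: (df_map (g := c)). Qed.

Lemma df_sub (A B : set N) E {e : env N E} (P : E -> Prop) :
  A `<=` B -> definable_in (val : A -> N) P -> definable_in (val : B -> N) P.
Proof.
move=> AB; apply: (df_map (g := fun a : A => (exist _ (val a) (mem_set (AB _ (set_valP a))) : B))).
by [].
Qed.

Lemma df_set_cst (A : set N) E {e : env N E} a : A a -> term_in (val : A -> N) (fun _ : E => a).
Proof. by move=> Aa; exact: (tm_cst (val : A -> N) (exist _ a (mem_set Aa))). Qed.

(** The constant [b] becomes the new variable x_0, while the parameters from [A] remain
    constants. *)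
Lemma df_extract (A : set N) b E {e : env N E} (P : E -> Prop) :
  definable_in (val : (A `|` [set b] : set N) -> N) P ->
  exists Q : E -> N -> Prop, definable_in (val : A -> N) (fun w : E * N => Q w.1 w.2) /\
    forall x, P x <-> Q x b.
Proof.
move=> [p H].
pose g (a : (A `|` [set b] : set N)) : term L A (@esize _ _ _ e).+1 :=
  match pselect (A (val a)) with
  | left Aa => Cst L _ (exist _ (val a) (mem_set Aa))
  | right _ => Var L _ ord0
  end.
pose q := fsubst p (fun i => Var L A (lift ord0 i)) g.
exists (fun x y => sat val q (vcons y (evars x))); split; first by exists q.
move=> x; rewrite sat_fsubst /= -H.
have -> : (fun a => Defs.eval val (vcons b (evars x)) (g a)) = val.
  apply/funext => a; rewrite /g; case: pselect => //= nA; rewrite vcons0.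
  by have [|] := set_valP a.
have -> : (fun i => vcons b (@evars _ _ _ e x) (lift ord0 i)) = @evars _ _ _ e x; last by [].
by apply/funext => i; rewrite vconsS.
Qed.
End ParameterSets.

(** * The pregeometry axioms for the discrete closure *)

Section Discl.
Context {L : language} (N : structure L).
Hypothesis dlo : dlo_without_endpoints N.
Hypothesis dc : definably_complete N.
Hypothesis lom : locally_ominimal N.
Implicit Types (A B : set N) (x y b c : N).
Local Notation "x <' y" := (lt x y) (at level 70, no associativity).

(** By density no point of an interval is isolated in it. Conversely [isolated_near] gives every
    point of the line, in the set or not, a neighbourhood with no other point of the set. *)
Lemma disclP A x :
  discl A x <-> exists S, [/\ definable_in (val : A -> N) S, S x & ~ has_itv S].
Proof.
split=> [[p [px piso _]]|[S [[p Hp] Sx nS]]].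
  exists (defset1 val p); split => //; first by exists p.
  move=> [a [b [ab Hab]]]; have [y ay yb] := ltdense dlo ab.
  have [_ [V /(nbhs_itv dlo)[c [d [cy yd Hcd]]] VE]] := piso y (Hab y ay yb).
  have [t [yt td tb]] := lt_min dlo yd yb; have [z yz zt] := ltdense dlo yt.
  have : (V `&` defset1 val p) z.
    by split; [apply: Hcd => //; [exact: (lttr dlo cy yz)|exact: td]
              |apply: Hab; [exact: (lttr dlo ay yz)|exact: tb]].
  by rewrite VE /= => zy; rewrite zy in yz; exact: (ltirr dlo yz).
have dS : definable_in id S by apply: (@df_id _ _ _ (val : A -> N)); exists p.
have E y : defset1 val p y <-> S y by exact: Hp.
exists p; split; first exact/E.
  move=> y Sy; split; first exact/mem_set.
  have [a [b [ay yb H]]] := isolated_near dlo lom y dS nS.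
  exists [set z | a <' z /\ z <' b]; first by apply/(nbhs_itv dlo); exists a, b.
  apply/seteqP; split=> [z [[az zb] /E Sz]|z /= ->]; first exact: H.
  by split.
move=> y Hy; apply/E; apply: contrapT => nSy.
have [a [b [ay yb H]]] := isolated_near dlo lom y dS nS.
have /Hy[z [/E Sz [az zb]]] : nbhs y [set z | a <' z /\ z <' b].
  by apply/(nbhs_itv dlo); exists a, b.
by apply: nSy; rewrite -(H z az zb Sz).
Qed.

Lemma discl_sub A B x : A `<=` B -> discl A x -> discl B x.
Proof.
move=> AB /disclP[S [dS Sx nS]]; apply/disclP; exists S; split => //.
exact: df_sub AB dS.
Qed.

Lemma discl_refl A x : A x -> discl A x.
Proof.
move=> Ax; apply/disclP; exists (fun y => y = x); split => //.
  by apply: df_eq; [exact: tm_id|exact: df_set_cst].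
move=> [a [b [ab H]]]; have [y ay yb] := ltdense dlo ab.
have [z yz zb] := ltdense dlo yb.
have E : y = z by rewrite (H y ay yb) (H z (lttr dlo ay yz) zb).
by rewrite E in yz; exact: (ltirr dlo yz).
Qed.

(** Fibres containing an interval are replaced by the empty set; the fibre over [b] is not
    affected. *)
Lemma discl_family A b c : discl (A `|` [set b]) c ->
  exists Q : N -> N -> Prop, [/\ definable_in (val : A -> N) (fun w : N * N => Q w.1 w.2),
    Q b c & forall y, ~ has_itv (Q y)].
Proof.
move=> /disclP[S [/df_extract[Q [dQ SQ]] Sc nS]].
exists (fun y x => Q x y /\ ~ has_itv (fun z => Q z y)); split.
- by dftac.
- by split; [exact/SQ|apply: contra_not nS; apply: has_itv_mono => x /SQ].
- move=> y hy; have [x [_ n]] := has_itv_ex dlo hy.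
  by apply: n; apply: has_itv_mono hy => z [].
Qed.

Lemma discl_trans A b c : discl (A `|` [set b]) c -> discl A b -> discl A c.
Proof.
move=> /discl_family[Q [dQ Qbc nQ]] /disclP[D [dD Db nD]]; apply/disclP.
exists (fun x => exists y, D y /\ Q y x); split; [by dftac|by exists b|].
exact: (discrete_union dlo dc lom (df_id dD) (df_id dQ) nD (fun y _ => nQ y)).
Qed.

(** If [Q^~ c] contained an interval, [c] would lie in the set of [x] with this property, which is
    definable over [A]. As [c] is not in the closure of [A], that set would contain an interval, and
    by [has_itv_exchange] so would some [Q y]. *)
Lemma discl_exchange A b c :
  discl (A `|` [set b]) c -> ~ discl A c -> discl (A `|` [set c]) b.
Proof.
move=> /discl_family[Q [dQ Qbc nQ]] nc; apply/disclP.
have sA : A `<=` A `|` [set c] by move=> x; left.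
have dQ' := df_sub sA dQ.
exists (Q^~ c); split => //.
  by apply: (df_rel2 dQ' (tm_id _)); apply: df_set_cst; right.
move=> hc; apply: nc; apply/disclP; exists (fun x => has_itv (Q^~ x)); split => //.
  by dftac.
move=> hh; have [|y hy] := has_itv_exchange dlo dc lom (W := fun x y => Q y x) _ hh.
  by have dQ1 := df_id dQ; cbv beta; dftac.
exact: nQ hy.
Qed.
End Discl.

(** * Elementarity with parameters *)

Section Constants.
Context {L : language}.

Fixpoint tconsts C n (t : term L C n) : set C :=
  match t with
  | Var _ => set0
  | Cst a => [set a]
  | App f ts => \bigcup_k tconsts (ts k)
  end.

Fixpoint fconsts C n (p : formula L C n) : set C :=
  match p with
  | Equ _ s t => tconsts s `|` tconsts t
  | Rel _ r ts => \bigcup_k tconsts (ts k)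
  | Neg _ q => fconsts q
  | And _ q r => fconsts q `|` fconsts r
  | Ex _ q => fconsts q
  end.

Lemma finite_tconsts C n (t : term L C n) : finite_set (tconsts t).
Proof. by elim: t => //= f ts IH; apply: bigcup_finite. Qed.

Lemma finite_fconsts C n (p : formula L C n) : finite_set (fconsts p).
Proof.
elim: p => {n} //= [n s t|n r ts|n q IHq r IHr].
- by rewrite finite_setU; split; exact: finite_tconsts.
- by apply: bigcup_finite => // i _; exact: finite_tconsts.
- by rewrite finite_setU.
Qed.

Lemma eval_agree (N : structure L) C (c c' : C -> N) n (t : term L C n) v :
  {in tconsts t, c =1 c'} -> Defs.eval c v t = Defs.eval c' v t.
Proof.
elim: t => [i|a|f ts IH] //= H; first by apply: H; exact: mem_set.
congr fun_interp; apply/funext => k; apply: IH => a /set_mem ak.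
by apply: H; apply: mem_set; exists k.
Qed.

Lemma sat_agree (N : structure L) C (c c' : C -> N) n (p : formula L C n) v :
  {in fconsts p, c =1 c'} -> sat c p v <-> sat c' p v.
Proof.
elim: p v => {n} /= [n s t|n r ts|n q IH|n q IHq r IHr|n q IH] v H.
- by rewrite !(eval_agree (c' := c')) // => a /set_mem aP; apply: H; apply: mem_set; [right|left].
- suff -> : (fun k => Defs.eval c v (ts k)) = (fun k => Defs.eval c' v (ts k)) by [].
  apply/funext => k; apply: eval_agree => a /set_mem ak.
  by apply: H; apply: mem_set; exists k.
- by rewrite IH.
- by rewrite IHq ?IHr // => a /set_mem aP; apply: H; apply: mem_set; [right|left].
- by split=> -[x Hx]; exists x; exact/(IH _ H).
Qed.

Definition fcat (N : Type) n m (x : 'I_n -> N) (v : 'I_m -> N) (i : 'I_(n + m)) : N :=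
  match fintype.split i with inl k => x k | inr k => v k end.

Lemma fcat_lshift N n m (x : 'I_n -> N) (v : 'I_m -> N) i : fcat x v (lshift m i) = x i.
Proof. by rewrite /fcat; case: splitP => k /= E; [congr x; exact/val_inj|have := ltn_ord i; rewrite E ltnNge leq_addr]. Qed.

Lemma fcat_rshift N n m (x : 'I_n -> N) (v : 'I_m -> N) i : fcat x v (rshift n i) = v i.
Proof. by rewrite /fcat; case: splitP => k /= E; [have := ltn_ord k; rewrite -E ltnNge leq_addr|congr v; apply/val_inj/(@addnI n)]. Qed.

Lemma comp_fcat (N N' : Type) (j : N -> N') n m (x : 'I_n -> N) (v : 'I_m -> N) :
  j \o fcat x v = fcat (j \o x) (j \o v).
Proof. by apply/funext => i /=; rewrite /fcat; case: (fintype.split i). Qed.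

(** Elementarity is given for formulas without constants, so the finitely many constants of [p] are
    made variables, numbered by the list [s] of their values. The successor keeps the index type
    inhabited when [s] is empty. *)
Lemma elementary_sat (M U : structure L) (j : M -> U) : elementary_embedding j ->
  forall C (c : C -> M) n (p : formula L C n) (v : 'I_n -> M),
  sat c p v <-> sat (j \o c) p (j \o v).
Proof.
move=> j_elem C c n p v.
have [x0] := dom_inhabited M.
have /finite_seqP[s Es] : finite_set (c @` fconsts p).
  exact: finite_image (finite_fconsts p).
pose g (a : C) : 'I_(size s).+1 := inord (index (c a) s).
pose e (k : 'I_(size s).+1) := nth x0 s k.
have eg : {in fconsts p, c =1 e \o g}.
  move=> a /set_mem ap; have cas : c a \in s.
    have : (c @` fconsts p) (c a) by exists a.
    by rewrite Es.
  by rewrite /= /e /g inordK ?nth_index // ltnS index_size.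
pose q : formula L void (n + (size s).+1) :=
  fsubst p (fun i => Var L void (lshift _ i)) (fun a => Var L void (rshift _ (g a))).
have E (N : structure L) (c' : C -> N) (e' : _ -> N) v' : {in fconsts p, c' =1 e' \o g} ->
    sat c' p v' <-> sat (of_void N) q (fcat v' e').
  move=> /sat_agree ->; rewrite sat_fsubst /=.
  have -> : (fun a => fcat v' e' (rshift n (g a))) = e' \o g.
    by apply/funext => a; rewrite fcat_rshift.
  suff -> : (fun i => fcat v' e' (lshift (size s).+1 i)) = v' by [].
  by apply/funext => a; rewrite fcat_lshift.
rewrite (E M c e v eg) (j_elem _ q _ (fun _ => I)) comp_fcat -(E U (j \o c)) //.
by move=> a /eg /= ->.
Qed.

End Constants.

(** * Small sets *)

Section Small.
Context {K : Type} {T : eqType}.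
Hypothesis infK : infinite_set [set: K].

(** An infinite [B] makes room for [a] by a shift along a sequence of distinct points; a finite [B]
    stays finite, while [K] is infinite. *)
Lemma card_lt_setU1 (B : set T) a :
  card_lt B [set: K] -> card_lt (B `|` [set a]) [set: K].
Proof.
move=> [BK nKB].
have [fB|iB] := pselect (finite_set B).
  have fBa : finite_set (B `|` [set a]) by rewrite finite_setU; split.
  split; last by move=> /card_le_finite/(_ fBa).
  apply: card_le_trans (proj1 (infiniteP _) infK); exact: finite_set_countable.
suff H : B `|` [set a] #<= B.
  by split; [exact: card_le_trans H BK|move=> H'; apply: nKB; exact: card_le_trans H' H].
have [h [hB hinj]] : exists h : nat -> T, (forall i, B (h i)) /\ injective h.
  move/infiniteP : iB => /card_leP[f].
  exists (fun i => val (f (exist _ i (mem_set I)))); split.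
    by move=> i; exact: set_valP.
  move=> i k /val_inj /inj H.
  by have [] := H (mem_set I) (mem_set I).
pose s x := if x == a then h 0 else
  if pselect (exists i, h i = x) is left ex then h (projT1 (cid ex)).+1 else x.
have [Ba|nBa] := pselect (B a).
  by apply: subset_card_le => x [//|->].
have s_inj : {in B `|` [set a] &, injective s}.
  move=> x y _ _; rewrite /s; case: eqP => [->|xa]; case: eqP => [->//|ya].
  - case: pselect => [ex|nex]; first by move/hinj.
    by move=> E; case: nex; exists 0.
  - case: pselect => [ex|nex]; first by move/hinj.
    by move=> E; case: nex; exists 0.
  - case: pselect => [ex|nex]; case: pselect => [ey|ney].
    + by move/hinj => -[/(congr1 h)]; rewrite (projT2 (cid ex)) (projT2 (cid ey)).
    + by move=> E; case: ney; eexists; exact: E.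
    + by move=> E; case: nex; eexists; exact: esym E.
    + by [].
have sB : s @` (B `|` [set a]) `<=` B.
  move=> _ [x Hx <-]; rewrite /s; case: eqP => // xa.
  case: pselect => // nex; by case: Hx.
apply: card_le_trans (subset_card_le sB).
by have := inj_card_eq s_inj; rewrite card_eq_le => /andP[].
Qed.

End Small.

(** * Rank in a pregeometry *)

Section Independence.
Context {S : choiceType} (cl : set S -> set S).
Hypothesis cl_sub : forall A B x, A `<=` B -> cl A x -> cl B x.
Hypothesis cl_refl : forall A x, A x -> cl A x.
Hypothesis cl_trans : forall A b c, cl (A `|` [set b]) c -> cl A b -> cl A c.
Hypothesis cl_exchange : forall A b c,
  cl (A `|` [set b]) c -> ~ cl A c -> cl (A `|` [set c]) b.
Implicit Types (A B : set S).

(** Independence of a family instead of a set: since closures contain their generators, repeated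
    entries are excluded. *)
Definition indep d B (b : 'I_d -> S) :=
  forall i, ~ cl ((b @` [set k | k != i]) `|` B) (b i).

(** If [e] brought some [b i] into the closure of the others, exchange would bring [e] into the
    closure of [B] and [b]. *)
Lemma indep_add d B (b : 'I_d -> S) e :
  indep B b -> ~ cl (B `|` range b) e -> indep (B `|` [set e]) b.
Proof.
move=> ib ne i; rewrite setUA => /cl_exchange/(_ (ib i)) H; apply: ne.
by apply: cl_sub H => x [[[k _ <-]|?]|->]; [right; exists k|left|right; exists i].
Qed.

Lemma indep_cons d B (b : 'I_d.+1 -> S) :
  indep B b <-> indep B (b \o lift ord0) /\ ~ cl (B `|` range (b \o lift ord0)) (b ord0).
Proof.
split=> [ib|[ib nb] i].
  split=> [i|]; last first.
    move=> H; apply: (ib ord0); apply: cl_sub H => x [?|[k _ <-]]; [by right|left].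
    by exists (lift ord0 k).
  move=> H; apply: (ib (lift ord0 i)); apply: cl_sub H => x [[k ki <-]|]; [left|by right].
  by exists (lift ord0 k) => //=; rewrite (inj_eq lift_inj).
case: (unliftP ord0 i) => [k|] ->.
  have ia := indep_add ib nb.
  move=> H; apply: (ia k); apply: cl_sub H => x [[l lk <-]|?]; last by right; left.
  case: (unliftP ord0 l) lk => [m|] -> /= lk; last by right; right.
  by left; exists m => //=; rewrite (inj_eq lift_inj) in lk.
move=> H; apply: nb; apply: cl_sub H => x [[l lk <-]|?]; [right|by left].
by case: (unliftP ord0 l) lk => [m|] -> //= lk; exists m.
Qed.

(** The exchange step of Steinitz: [z] is the first element of [g] whose addition puts [x] in the
    closure, and [x] takes its place. *)
Lemma exchange_seq (g : seq S) B x : ~ cl B x -> cl (B `|` [set` g]) x ->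
  exists z g', [/\ size g = (size g').+1, [set` g] `<=` [set` g'] `|` [set z] &
    cl (B `|` [set x] `|` [set` g']) z].
Proof.
elim: g B => [|y g IH] B nx.
  by rewrite set_nil setU0.
move=> H; have [yx|nyx] := pselect (cl (B `|` [set y]) x).
  exists y, g; split => //.
    by move=> z /=; rewrite inE => /orP[/eqP->|]; [right|left].
  by apply: cl_sub (cl_exchange yx nx) => z; left.
have [|z [g' [sg gg' Hz]]] := IH _ nyx.
  apply: cl_sub H => z [?|/=]; first by left; left.
  by rewrite inE => /orP[/eqP->|]; [left; right|right].
exists z, (y :: g'); split => /=; first by rewrite sg.
  move=> w /=; rewrite inE => /orP[/eqP->|/gg'[]]; [left|move=> /= wg'; left|right] => //=.
    by rewrite mem_head.
  by rewrite inE wg' orbT.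
apply: cl_sub Hz => w [[[?|->]|->]|/= wg'].
- by left; left.
- by right => /=; rewrite mem_head.
- by left; right.
- by right; rewrite /= inE wg' orbT.
Qed.

(** By induction on [d]: [b ord0] replaces one generator and joins the base. *)
Lemma steinitz d B (b : 'I_d -> S) (g : seq S) :
  indep B b -> (forall i, cl (B `|` [set` g]) (b i)) -> d <= size g.
Proof.
elim: d B b g => // d IH B b g /indep_cons[ib nb] bg.
have nb0 : ~ cl B (b ord0) by move=> H; apply: nb; apply: cl_sub H => x; left.
have [z [g' [-> gg' Hz]]] := exchange_seq nb0 (bg ord0).
rewrite ltnS; apply: (IH (B `|` [set b ord0]) (b \o lift ord0)).
  exact: indep_add.
move=> i; apply: (cl_trans _ Hz); apply: cl_sub (bg (lift ord0 i)) => x [?|/gg'[?|->]].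
- by left; left; left.
- by left; right.
- by right.
Qed.

Lemma basis_seq_ex (l : seq S) B : exists s : seq S,
  [/\ [set` s] `<=` [set` l], [set` l] `<=` cl ([set` s] `|` B) &
      independent_over cl [set` s] B].
Proof.
elim: l => [|x l [s [sl ls inds]]]; first by exists [::]; split => // x.
have [clx|nclx] := pselect (cl ([set` s] `|` B) x).
  exists s; split => //.
    by move=> y /sl /= yl; rewrite inE yl orbT.
  by move=> y /=; rewrite inE => /orP[/eqP->|/ls].
exists (x :: s); split.
- by move=> y /=; rewrite !inE => /orP[->//|/sl /= ->]; rewrite orbT.
- move=> y /=; rewrite inE => /orP[/eqP->|/ls].
    by apply: cl_refl; left; rewrite /= mem_head.
  by apply: cl_sub => z [/= zs|]; [left; rewrite /= inE zs orbT|right].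
move=> a /=; rewrite inE => as_ H.
have [xa|/eqP xa] := eqVneq a x.
  apply: nclx; rewrite -xa; apply: cl_sub H => y [[/= ys ya]|]; [left|by right].
  by move: ys; rewrite inE -xa => /orP[/eqP|].
have {}as_ : a \in s by case/orP: as_ => // /eqP.
have H1 : cl ((([set` s] `\ a) `|` B) `|` [set x]) a.
  apply: cl_sub H => y [[/= ys ya]|]; last by left; right.
  by move: ys; rewrite inE => /orP[/eqP->|ys]; [right|left; left].
apply: nclx; apply: cl_sub (cl_exchange H1 (inds _ as_)) => y [[[ys _]|]|->].
- by left.
- by right.
- by left.
Qed.

(** A finite basis exists, so [rk] does not take its default value. *)
Lemma rkP A B : finite_set A -> exists2 A0, basis_over cl A0 A B & A0 #= `I_(rk cl A B).
Proof.
move=> /finite_seqP[l ->]; have [s [sl ls inds]] := basis_seq_ex l B.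
have /finite_setP[k sk] : finite_set [set` s] by exact: finite_seq.
pose P := [set k | exists2 A0, basis_over cl A0 [set` l] B & A0 #= `I_k].
have : P (rk cl [set` l] B) by apply: (@xgetPex _ 0 P); exists k, [set` s].
by [].
Qed.

(** Keeping only the least index of each value makes [a] injective, and listing the indices in order
    makes [f] increasing, as the projections in [dim] must be. *)
Lemma card_image_enum n (a : 'I_n -> S) A0 k : A0 `<=` range a -> A0 #= `I_k ->
  exists f : 'I_k -> 'I_n, [/\ {homo f : i m / (i < m)%N}, injective (a \o f) &
    range (a \o f) = A0].
Proof.
move=> A0a A0k.
pose F : {set 'I_n} := [set i | `[< A0 (a i) >] & [forall m : 'I_n, (a m == a i) ==> (i <= m)%N]].
pose f (i : 'I_#|F|) : 'I_n := enum_val i.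
have fF i : f i \in F by exact: enum_valP.
have finj : injective (a \o f).
  move=> i m /= E; apply: enum_val_inj; apply/val_inj/eqP; rewrite eqn_leq.
  have := fF i; have := fF m; rewrite !inE => /andP[_ /forallP/(_ (f i)) H1] /andP[_ /forallP/(_ (f m)) H2].
  by move: H1 H2; rewrite E eqxx /= => -> ->.
have fA : range (a \o f) = A0.
  apply/seteqP; split=> [_ [i _ <-]|x A0x].
    by have := fF i; rewrite inE => /andP[/asboolP].
  have [i0 _ ai0] := A0a x A0x.
  have P0 : a i0 == x by apply/eqP.
  have [i /eqP ai imin] := (@arg_minnP _ i0 (fun i => a i == x) val P0).
  have iF : i \in F.
    rewrite inE ai; apply/andP; split; first exact/asboolP.
    by apply/forallP => m; apply/implyP => /imin.
  by exists (enum_rank_in iF i) => //=; rewrite /f enum_rankK_in.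
have E : #|F| = k.
  apply/card_eq_II; apply: card_eq_trans A0k; rewrite -fA.
  have <- : (val @` [set: 'I_#|F|]) = `I_#|F|.
    apply/seteqP; split=> [_ [i _ <-] /=|m /= mF]; first exact: ltn_ord.
    by exists (Ordinal mF).
  have vI : val @` [set: 'I_#|F|] #= [set: 'I_#|F|].
    by apply: inj_card_eq => x y _ _; exact: val_inj.
  apply: card_eq_trans vI _; rewrite card_eq_sym; apply: inj_card_eq.
  by move=> x y _ _; exact: finj.
have fhomo : {homo f : i m / (i < m)%N}.
  have sF : sorted ltn (map val (enum F)).
    have -> : map val (enum F) = [seq i <- iota 0 n | [exists m in F, val m == i]].
      rewrite -val_enum_ord filter_map enumT /enum_mem; congr map.
      apply: eq_filter => m /=; apply/idP/existsP => [mF|[m' /andP[m'F /eqP/val_inj <-//]]].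
      by exists m; rewrite mF eqxx.
    exact/sorted_filter/iota_ltn_sorted/ltn_trans.
  move=> i m im; have x0 := f i.
  have nthf (l : 'I_#|F|) : val (f l) = nth 0 (map val (enum F)) l.
    by rewrite (nth_map x0) -?cardE // /f (enum_val_nth x0).
  rewrite [X in (X < _)%N]nthf [X in (_ < X)%N]nthf.
  by apply: (sorted_ltn_nth ltn_trans) => //; rewrite inE size_map -cardE.
by case: k / E A0k => A0k; exists f.
Qed.
End Independence.

(** * Independent points and boxes in a saturated model *)

HB.instance Definition _ L C n := gen_eqMixin (formula L C n).

Section Generic.
Context {L : language} (K : Type) (U : structure L).
Hypothesis dlo : dlo_without_endpoints U.
Hypothesis dc : definably_complete U.
Hypothesis lom : locally_ominimal U.
Hypothesis infK : infinite_set [set: K].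
Hypothesis satU : saturated K U.
Implicit Types (B : set U) (a b c x y : U).
Local Notation "x <' y" := (lt x y) (at level 70, no associativity).
Local Notation small B := (card_lt B [set: K]).

(** Saturation realises the type of all formulas whose sets are large in (a, b): they meet every [J]
    with interior there in a set with interior. Largeness passes to finite intersections, and the
    complement of a definable set without interior is large. *)
Lemma generic_point B a b : small B -> a <' b ->
  exists x, [/\ a <' x, x <' b & ~ discl B x].
Proof.
move=> sB ab.
pose B' := B `|` [set a] `|` [set b].
have BB' : B `<=` B' by move=> x; left; left.
pose P : set (formula L B' 1) := [set p | forall J : U -> Prop,
  (forall x, J x -> a <' x /\ x <' b) -> has_itv J -> has_itv (fun x => J x /\ defset1 val p x)].
have [||x Hx] := satU (B := B') (P := P).
- by do 2! apply: card_lt_setU1 => //.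
- move=> F /finite_seqP[s ->] sP.
  suff [J [_ /(has_itv_ex dlo)[x Jx] H]] : exists J : U -> Prop,
      [/\ forall x, J x -> a <' x /\ x <' b, has_itv J &
          forall x p, J x -> p \in s -> defset1 val p x].
    by exists x => p ps; exact: H.
  elim: s sP => [_|p s IH sP].
    exists (fun x => a <' x /\ x <' b); split => //; exact: has_itv_segment.
  have [q qs|J [Jab hJ Js]] := IH; first by apply: sP; rewrite /= inE qs orbT.
  exists (fun x => J x /\ defset1 val p x); split.
  + by move=> x [/Jab].
  + by apply: (sP p) => //=; rewrite mem_head.
  + by move=> x q [Jx px]; rewrite inE => /orP[/eqP->//|]; exact: Js.
have inP (S : U -> Prop) : definable_in (val : B' -> U) S ->
    (forall J : U -> Prop, (forall x, J x -> a <' x /\ x <' b) -> has_itv J -> has_itv (fun x => J x /\ S x)) ->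
    S x.
  move=> [p Hp] H; apply/(Hp x); apply: Hx => J Jab hJ.
  by apply: has_itv_mono (H J Jab hJ) => y [Jy /(Hp y)].
have [ax xb] : a <' x /\ x <' b.
  apply: (inP (fun x => a <' x /\ x <' b)).
    apply: df_and; apply: df_lt; (try exact: tm_id); apply: df_set_cst; [|by right].
    by left; right.
  by move=> J Jab; apply: has_itv_mono => y Jy; split => //; exact: Jab.
exists x; split => // /(disclP dlo lom)[S [dS Sx nS]].
have := inP (fun x => ~ S x) (df_not (df_sub BB' dS)); apply=> // J Jab hJ.
have [y Jy|H|//] := has_itv_or dlo lom (S2 := fun x => ~ S x) (df_id dS) hJ.
  by case: (pselect (S y)); [left|right].
by case: nS; apply: has_itv_mono H => y [].
Qed.

Local Notation indep := (indep discl).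

Let cl_sub := @discl_sub L U dlo lom.
Let cl_exchange := @discl_exchange L U dlo dc lom.

Lemma small_range B d (b : 'I_d -> U) : small B -> small (B `|` range b).
Proof.
move=> sB.
have /finite_seqP[s ->] : finite_set (range b).
  exact: finite_image (finite_finset (X := [set: 'I_d])).
elim: s => [|x s IH]; first by rewrite set_nil setU0.
have -> : [set` x :: s] = [set` s] `|` [set x].
  apply/seteqP; split=> y /=; rewrite inE.
    by move=> /orP[/eqP->|]; [right|left].
  by case=> [->|->]; rewrite ?eqxx ?orbT.
by rewrite setUA; exact: card_lt_setU1.
Qed.

Lemma vcons_tail d (v : 'I_d.+1 -> U) : vcons (v ord0) (v \o lift ord0) = v.
Proof.
apply/funext => i; case: (unliftP ord0 i) => [k|] ->; by rewrite ?vcons0 ?vconsS.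
Qed.

Lemma box_indep d B (u w : 'I_d -> U) : small B -> (forall i, u i <' w i) ->
  exists2 b, forall i, u i <' b i /\ b i <' w i & indep B b.
Proof.
elim: d u w => [|d IH] u w sB uw.
  by exists u; case.
have [|b Hb ib] := IH (u \o lift ord0) (w \o lift ord0) sB; first by move=> i; exact: uw.
have [x [ux xw nx]] := generic_point (small_range b sB) (uw ord0).
exists (vcons x b).
  move=> i; case: (unliftP ord0 i) => [k|] ->; first by rewrite vconsS; exact: (Hb k).
  by rewrite vcons0.
apply/(indep_cons cl_sub cl_exchange).
have -> : vcons x b \o lift ord0 = b by apply/funext => i /=; rewrite vconsS.
by rewrite vcons0.
Qed.

(* The last coordinate of [b] is interior to the fibre of [Y]; take ends [e1], [e2]
   of an interval of the fibre generic enough for the other coordinates to remain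
   independent, and apply the induction hypothesis to the points over which the
   fibre contains that interval. *)
Lemma indep_box d B (Y : ('I_d -> U) -> Prop) (b : 'I_d -> U) : small B ->
  definable_in (val : B -> U) Y -> indep B b -> Y b -> exists u w, is_box u w Y.
Proof.
elim: d B Y b => [|d IH] B Y b sB dY ib Yb.
  exists b, b; split => [[]//|v _].
  by have <- // : b = v by apply/funext; case.
have [ib' nc] := (indep_cons cl_sub cl_exchange B b).1 ib.
set b' := b \o lift ord0 in ib' nc; set c := b ord0 in nc.
have Ybc : Y (vcons c b') by rewrite vcons_tail.
pose B1 := B `|` range b'.
pose S x := Y (vcons x b').
have dS : definable_in (val : B1 -> U) S.
  apply: (df_comp (h := fun x => vcons x b') (df_sub _ dY)) => [x|i]; first by left.
  case: (unliftP ord0 i) => [k|] ->.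
    have [s Hs] : term_in (val : B1 -> U) (fun _ : U => b' k).
      by apply: df_set_cst; right; exists k.
    by exists s => x; rewrite Hs /= vconsS.
  by have [s Hs] := tm_id (val : B1 -> U); exists s => x; rewrite Hs /= vcons0.
have [p [q [pc [cq Hpq]]]] : exists p q, p <' c /\ c <' q /\
    forall y, p <' y -> y <' q -> S y.
  (* Otherwise [c] would be a non-interior point of [S]. The set of these is definable over [B1] and
     contains no interval, so [c] would be in the closure of [B1]. *)
  apply: contrapT => nint; apply: nc; apply/(disclP dlo lom).
  exists (fun x => S x /\ ~ exists p q, p <' x /\ x <' q /\
    forall y, p <' y -> y <' q -> S y); split => //; first by dftac.
  move=> [p [q [pq Hpq]]]; have [x px xq] := ltdense dlo pq.
  have [_ []] := Hpq x px xq; exists p, q; split => //; split => // y py yq.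
  by have [] := Hpq y py yq.
have sB1 : small B1 by exact: small_range.
(* [e1] is generic over [B] and [b'], then [e2] over [B], [e1] and [b'], so that [indep_add] applies
   twice. *)
have [e1 [pe1 e1c ne1]] := generic_point sB1 pc.
pose B2 := B `|` [set e1].
have sB2 : small B2 by exact: card_lt_setU1.
have [e2 [ce2 e2q ne2]] := generic_point (small_range b' sB2) cq.
have ib2 : indep (B2 `|` [set e2]) b'.
  by apply: (indep_add cl_sub cl_exchange) => //; exact: (indep_add cl_sub cl_exchange).
pose Y' (v : 'I_d -> U) := forall x, e1 <' x -> x <' e2 -> Y (vcons x v).
have dY' : definable_in (val : (B2 `|` [set e2] : set U) -> U) Y'.
  apply: (df_all (Q := fun v x => e1 <' x -> x <' e2 -> Y (vcons x v))).
  apply: df_imp.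
    by apply: df_lt; [apply: df_set_cst; left; right|exact: tm_snd].
  apply: df_imp.
    by apply: df_lt; [exact: tm_snd|apply: df_set_cst; right].
  apply: (df_sub (A := B)); first by move=> x; left; left.
  by have [r Hr] := dY; exists r => -[v x]; exact: Hr.
have [u [w [uw Hw]]] : exists u w, is_box u w Y'.
  apply: IH dY' ib2 _; first exact: card_lt_setU1.
  by move=> x e1x xe2; apply: Hpq; [exact: (lttr dlo pe1 e1x)|exact: (lttr dlo xe2 e2q)].
exists (vcons e1 u), (vcons e2 w); split.
  move=> i; case: (unliftP ord0 i) => [k|] ->; rewrite ?vcons0 ?vconsS //.
  exact: (lttr dlo e1c ce2).
move=> v Hv; rewrite -(vcons_tail v); apply: Hw.
- by move=> i; have := Hv (lift ord0 i); rewrite !vconsS.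
- by have := Hv ord0; rewrite !vcons0 => -[].
- by have := Hv ord0; rewrite !vcons0 => -[].
Qed.

End Generic.

(** * Transfer of boxes along an elementary embedding *)

Section BoxFormulas.
Context {L : language} {C : Type}.

Fixpoint exists_block n m : formula L C (n + m) -> formula L C m :=
  match n with
  | 0 => fun p => p
  | n'.+1 => fun p => @exists_block n' m (Ex p)
  end.

Lemma vcons_fcat (N : structure L) n m x0 (x : 'I_n -> N) (v : 'I_m -> N) :
  vcons x0 (fcat x v) = fcat (vcons x0 x) v.
Proof.
apply/funext => i; case: (unliftP ord0 i) => [k|] ->.
  rewrite vconsS; case: (split_ordP k) => [l|l] ->.
    rewrite fcat_lshift; have -> : lift ord0 (lshift m l) = lshift m (lift ord0 l).
      exact/val_inj.
    by rewrite fcat_lshift vconsS.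
  rewrite fcat_rshift; have -> : lift ord0 (rshift n l) = rshift n.+1 l by exact/val_inj.
  by rewrite fcat_rshift.
have -> : ord0 = lshift m (@ord0 n) by exact/val_inj.
rewrite fcat_lshift vcons0.
have -> : lshift m (@ord0 n) = ord0 by exact/val_inj.
by rewrite vcons0.
Qed.

Lemma sat_exists_block (N : structure L) (c : C -> N) n m (p : formula L C (n + m)) v :
  sat c (exists_block p) v <-> exists x : 'I_n -> N, sat c p (fcat x v).
Proof.
elim: n p => [|n IH] p /=.
  have E (x : 'I_0 -> N) : fcat x v = v.
    apply/funext => i; have -> : i = rshift 0 i by exact/val_inj.
    by rewrite fcat_rshift; congr v; exact/val_inj.
  have [x0] := dom_inhabited N.
  by split=> [H|[x]]; [exists (fun=> x0)|]; rewrite E.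
rewrite IH; split=> [[x [x0 H]]|[x H]].
  by exists (vcons x0 x); rewrite -vcons_fcat.
exists (x \o lift ord0), (x ord0); rewrite vcons_fcat.
by have -> : vcons (x ord0) (x \o lift ord0) = x by exact: vcons_tail.
Qed.

(* A tautology with neither free variables nor constants: atomic formulas need a term. *)
Definition true_formula n : formula L C n := Ex (Equ (Var L C ord0) (Var L C ord0)).

Definition conj_formula k n (F : 'I_k -> formula L C n) : formula L C n :=
  foldr (fun i p => And (F i) p) (true_formula n) (enum 'I_k).

Lemma sat_conj_formula (N : structure L) (c : C -> N) k n (F : 'I_k -> formula L C n) v :
  sat c (conj_formula F) v <-> forall i, sat c (F i) v.
Proof.
suff H (s : seq 'I_k) : sat c (foldr (fun i p => And (F i) p) (true_formula n) s) v <->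
    forall i, i \in s -> sat c (F i) v.
  by rewrite H; split=> Hs i *; apply: Hs; rewrite mem_enum.
elim: s => [|i s IH] /=.
  by split=> // _; have [x0] := dom_inhabited N; exists x0.
rewrite IH; split=> [[Fi Fs] k'|Fs].
  by rewrite inE => /orP[/eqP->|/Fs].
by split=> [|k' k's]; apply: Fs; rewrite ?mem_head // inE k's orbT.
Qed.

Definition lt_formula n (s t : term L C n) : formula L C n :=
  Rel (fun k : 'I_(rarity (lt_sym L)) => if k == 0 :> nat then s else t).

Lemma sat_lt_formula (N : structure L) (c : C -> N) n (s t : term L C n) v :
  sat c (lt_formula s t) v <-> lt (Defs.eval c v s) (Defs.eval c v t).
Proof.
rewrite /lt /=; set f := (X in rel_interp X); set g := (X in _ <-> rel_interp X).
by have -> : f = g by apply/funext => k; rewrite /f /g; case: ifP.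
Qed.

Section Projection.
Context {n d : nat} (f : 'I_d -> 'I_n) (q : formula L C n).

(** The [m] further variables leave room for the ends of the box in [box_formula]. *)
Definition proj_formula m : formula L C (d + m) := @exists_block n (d + m)
  (And (fsubst q (fun i => Var L C (lshift _ i)) (fun a => Cst L _ a))
       (conj_formula (fun i : 'I_d => Equ (Var L C (lshift _ (f i)))
                                  (Var L C (rshift n (lshift m i)))))).

Lemma sat_proj_formula (N : structure L) (c : C -> N) m (v : 'I_d -> N) (z : 'I_m -> N) :
  sat c (proj_formula m) (fcat v z) <-> exists x, sat c q x /\ forall i, x (f i) = v i.
Proof.
have qE x : sat c (fsubst q (fun i => Var L C (lshift (d + m) i)) (fun a => Cst L _ a))
    (fcat x (fcat v z)) <-> sat c q x.
  rewrite sat_fsubst /=.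
  suff -> : (fun i => fcat x (fcat v z) (lshift (d + m) i)) = x by [].
  by apply/funext => i; rewrite fcat_lshift.
rewrite sat_exists_block; split=> -[x].
  move=> [/qE qx /sat_conj_formula xv]; exists x; split => // i.
  by have := xv i; rewrite /= !(fcat_lshift, fcat_rshift).
move=> [qx xv]; exists x; split; first exact/qE.
by apply/sat_conj_formula => i; rewrite /= !(fcat_lshift, fcat_rshift).
Qed.

(** The free variables are the lower ends, then the upper ends, then an empty block that closes the
    nested [fcat]. *)
Definition box_formula : formula L C (d + (d + 0)) := Neg (@exists_block d (d + (d + 0))
  (And (conj_formula (fun i : 'I_d =>
         And (lt_formula (Var L C (rshift d (lshift (d + 0) i))) (Var L C (lshift _ i)))
             (lt_formula (Var L C (lshift _ i)) (Var L C (rshift d (rshift d (lshift 0 i)))))))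
       (Neg (proj_formula _)))).

Lemma sat_box_formula (N : structure L) (c : C -> N) (u w : 'I_d -> N) (z : 'I_0 -> N) :
  sat c box_formula (fcat u (fcat w z)) <->
  forall v, (forall i, lt (u i) (v i) /\ lt (v i) (w i)) ->
    exists x, sat c q x /\ forall i, x (f i) = v i.
Proof.
have cE v : sat c (conj_formula (fun i : 'I_d =>
    And (lt_formula (Var L C (rshift d (lshift (d + 0) i))) (Var L C (lshift _ i)))
        (lt_formula (Var L C (lshift _ i)) (Var L C (rshift d (rshift d (lshift 0 i)))))))
    (fcat v (fcat u (fcat w z))) <-> forall i, lt (u i) (v i) /\ lt (v i) (w i).
  rewrite sat_conj_formula; split=> H i; have := H i.
    move=> -[/sat_lt_formula H1 /sat_lt_formula H2]; move: H1 H2 => /=.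
    by rewrite !(fcat_lshift, fcat_rshift).
  by move=> -[? ?]; split; apply/sat_lt_formula; rewrite /= !(fcat_lshift, fcat_rshift).
rewrite [sat c box_formula _]/(~ sat c (exists_block _) _) sat_exists_block; split=> [H v Hv|H [v [/cE Hv]]].
  apply/(sat_proj_formula c v (fcat u (fcat w z))); apply: contrapT => nP; apply: H; exists v; split => //.
  exact/cE.
by apply; apply/sat_proj_formula; exact: H.
Qed.

Definition has_box_formula : formula L C 0 := @exists_block d 0 (@exists_block d (d + 0)
  (And (conj_formula (fun i : 'I_d =>
          lt_formula (Var L C (lshift _ i)) (Var L C (rshift d (lshift 0 i))))) box_formula)).

Lemma sat_has_box_formula (N : structure L) (c : C -> N) (z : 'I_0 -> N) :
  sat c has_box_formula z <-> exists u w : 'I_d -> N,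
    is_box u w (fun v => exists x, sat c q x /\ forall i, x (f i) = v i).
Proof.
have cE u w : sat c (conj_formula (fun i : 'I_d =>
    lt_formula (Var L C (lshift _ i)) (Var L C (rshift d (lshift 0 i))))) (fcat u (fcat w z)) <->
    forall i, lt (u i) (w i).
  rewrite sat_conj_formula; split=> H i; have := H i.
    by move/sat_lt_formula => /=; rewrite !(fcat_lshift, fcat_rshift).
  by move=> ?; apply/sat_lt_formula; rewrite /= !(fcat_lshift, fcat_rshift).
rewrite sat_exists_block; split=> [[w /sat_exists_block[u [/cE uw /sat_box_formula H]]]|[u [w [uw H]]]].
  by exists u, w.
by exists w; apply/sat_exists_block; exists u; split; [exact/cE|exact/sat_box_formula].
Qed.
End Projection.
End BoxFormulas.

(** * Comparison of dimension and rank *)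

Lemma max_nat_cofinal (D D' : set nat) n : (forall k, D k -> k <= n) -> D' `<=` D ->
  (forall d, D d -> exists2 k, D' k & d <= k) -> max_nat D = max_nat D'.
Proof.
move=> Dn D'D DD'.
suff E : (fun s : \bar nat => (D = set0 /\ s = -oo%E) \/
      exists m, [/\ D m, forall k, D k -> k <= m & s = m%:E]) =
    (fun s => (D' = set0 /\ s = -oo%E) \/
      exists m, [/\ D' m, forall k, D' k -> k <= m & s = m%:E]).
  by rewrite /max_nat; congr xget; exact: E.
apply/funext => s; apply/propext; split=> -[[D0 ->]|[m [Dm Dmax ->]]].
- by left; split => //; apply/seteqP; split => // k /D'D; rewrite D0.
- right; exists m; split => // [|k /D'D]; last exact: Dmax.
  have [k D'k mk] := DD' m Dm.
  by have -> : m = k by apply/eqP; rewrite eqn_leq mk Dmax //; exact: D'D.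
- by left; split => //; apply/seteqP; split => // k /DD'[l]; rewrite D0.
- right; exists m; split => // [|k /DD'[l D'l kl]]; first exact: D'D.
  exact: leq_trans kl (Dmax _ D'l).
Qed.

Theorem theorem3p5 (L : language) (T : set (sentence L))
  (T_dclom : dclom_theory T)
  (M : structure L) (M_model : models M T)
  (K : Type) (U : structure L) (U_model : models U T) (U_monster : monster K U)
  (j : M -> U) (j_elem : elementary_embedding j)
  (M_small : card_lt [set: M] [set: K])
  (A : set M) (n : nat) (X : set (pow M n)) (X_def : definable_over A X) :
  dim X = rk_discl j X A.
Proof.
have [dloM _ _] := T_dclom.2 M M_model.
have [dlo dc lom] := T_dclom.2 U U_model.
have [infK satU _] := U_monster.
have [q XE] := X_def.
pose cM : A -> M := val; pose cU : A -> U := j \o cM.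
pose B := j @` A.
have sB : card_lt B [set: K].
  have BM : B #<= [set: M].
    exact: card_le_trans (card_image_le j A) (card_leT A).
  split; first exact: card_le_trans BM (proj1 M_small).
  by move=> KB; apply: (proj2 M_small); exact: card_le_trans KB BM.
have df_B E (e : env U E) (P : E -> Prop) : definable_in cU P -> definable_in (val : B -> U) P.
  apply: (df_map (g := fun a : A => (exist _ (j (val a)) (mem_set (imageP j (set_valP a))) : B))).
  by [].
(* [extension] admits every formula over [M] that defines [X]. By elementarity all of them define
   the same set in [U], so [q] may be used. *)
have extE (a : pow U n) : extension j X a <-> sat cU q a.
  pose p' : formula L M n := fsubst q (fun i => Var L M i) (fun a => Cst L _ (val a)).
  have p'E (N : structure L) (c : M -> N) v : sat c p' v <-> sat (c \o cM) q v.
    by rewrite sat_fsubst.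
  split=> [[p Xp pa]|qa]; last first.
    exists p'; first by rewrite XE; apply/seteqP; split => v; rewrite /defset /= p'E.
    exact/p'E.
  apply/(p'E U j); apply: contrapT => np'a.
  pose r : formula L M (n + 0) := fsubst (And p (Neg p'))
    (fun i => Var L M (lshift 0 i)) (fun a => Cst L _ a).
  have rE (N : structure L) (c : M -> N) x (z : 'I_0 -> N) :
      sat c r (fcat x z) <-> sat c p x /\ ~ sat c p' x.
    rewrite sat_fsubst /=.
    suff -> : (fun i => fcat x z (lshift 0 i)) = x by [].
    by apply/funext => i; rewrite fcat_lshift.
  have [x0] := dom_inhabited M; pose z0 : 'I_0 -> M := fun=> x0.
  have : sat id (exists_block r) z0.
    apply/(elementary_sat j_elem); apply/sat_exists_block; exists a.
    exact/(rE U j).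
  move=> /sat_exists_block[x /rE[px]]; apply; apply/p'E.
  have : X x by rewrite Xp.
  by rewrite XE.
pose Y (N : structure L) (c : A -> N) d (f : 'I_d -> 'I_n) (v : 'I_d -> N) :=
  exists x, sat c q x /\ forall i, x (f i) = v i.
have dimE d : (exists2 f : 'I_d -> 'I_n, {homo f : i k / (i < k)%N} &
      (coord_proj f @` X)° !=set0) <->
    exists2 f : 'I_d -> 'I_n, {homo f : i k / (i < k)%N} &
      exists u w, is_box u w (Y M cM d f).
  have XY (f : 'I_d -> 'I_n) v : (coord_proj f @` X) v <-> Y M cM d f v.
    rewrite XE; split=> [[x qx <-]|[x [qx xv]]]; exists x => //.
    exact/funext.
  split=> -[f fhomo] H; exists f => //; [move/(interior_box dloM): H|apply/(interior_box dloM)];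
    [move=> [u [w [uw H]]]|move: H => [u [w [uw H]]]]; exists u, w; split => // v /H/XY //.
have cl_sub := @discl_sub L U dlo lom.
have cl_refl := @discl_refl L U dlo lom.
have cl_trans := @discl_trans L U dlo dc lom.
have cl_exchange := @discl_exchange L U dlo dc lom.
(* The two maxima agree because every rank of a tuple is the dimension of a projection with
   interior, and every such dimension is at most some rank. *)
rewrite /dim /rk_discl; apply: (@max_nat_cofinal _ _ n).
- move=> k /= [f fhomo _].
  have finj : injective f.
    move=> i m E; apply/val_inj; case: (ltngtP i m) => // /fhomo; rewrite E ltnn.
      by [].
    by [].
  by have := leq_card f finj; rewrite !card_ord.
(* A basis of [a], listed in increasing order of indices, is an independent tuple in a projection.
   That projection contains a box in [U], and the existence of a box is a sentence over [A], so it
   descends to [M]. *)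
- move=> _ [a /extE qa <-]; apply/dimE.
  have [A0 [A0a aA0 indA0] cA0] := rkP cl_sub cl_refl cl_exchange B (finite_image a (finite_finset (X := [set: 'I_n]))).
  have [f [fhomo finj fA0]] := card_image_enum A0a cA0.
  exists f => //.
  have ib : indep discl B (a \o f).
    move=> i H; apply: (indA0 (a (f i))); first by rewrite -fA0; exists i.
    apply: cl_sub H => x [[k ki <-]|]; [left|by right].
    split; first by rewrite -fA0; exists k.
    by move=> /= /finj E; rewrite E /= eqxx in ki.
  have dY : definable_in (val : B -> U) (Y U cU _ f).
    apply: df_B; exists (fsubst (proj_formula f q 0) (fun i => Var L A (cast_ord (addn0 _) i))
      (fun a => Cst L _ a)) => v.
    have [z0] := dom_inhabited U; apply: iff_trans (sat_proj_formula f q cU v (fun _ : 'I_0 => z0)).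
    rewrite sat_fsubst /=.
    suff -> : (fun i => v (cast_ord (addn0 _) i)) = fcat v (fun _ : 'I_0 => z0) by [].
    apply/funext => i; case: (split_ordP i) => [k|[]//] ->.
    by rewrite fcat_lshift; congr v; exact/val_inj.
  have [|u [w uw]] := indep_box dlo dc lom infK satU sB dY ib; first by exists a.
  have [x0] := dom_inhabited M; pose z0 : 'I_0 -> M := fun=> x0.
  apply/(sat_has_box_formula f q cM z0); apply/(elementary_sat j_elem).
  by apply/sat_has_box_formula; exists u, w.
(* The box in [M], read in [U], contains an independent tuple [b], the projection of some [a] in the
   extension of [X]. A basis of [a] generates [b], so by [steinitz] its size is at least [d]. *)
move=> d /dimE[f fhomo [u [w [uw H]]]].
have [x0] := dom_inhabited M; pose z0 : 'I_0 -> M := fun=> x0.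
have uwU i : lt (j (u i)) (j (w i)).
  have H0 : sat id (lt_formula (Cst L 0 (u i)) (Cst L 0 (w i))) z0 by apply/sat_lt_formula; exact: uw.
  by have /sat_lt_formula := (elementary_sat j_elem _ _ _).1 H0.
have [b Hb ib] := box_indep dlo dc lom infK satU (u := j \o u) (w := j \o w) sB uwU.
have /(elementary_sat j_elem) : sat cM (box_formula f q) (fcat u (fcat w z0)) by apply/sat_box_formula.
rewrite !comp_fcat => /sat_box_formula/(_ b Hb)[a [qa ab]].
exists (rk discl (range a) B); first by exists a => //; exact/extE.
have [A0 [A0a aA0 indA0] cA0] := rkP cl_sub cl_refl cl_exchange B (finite_image a (finite_finset (X := [set: 'I_n]))).
have [g [_ _ gA0]] := card_image_enum A0a cA0.
have -> : rk discl (range a) B = size [seq a (g i) | i <- enum 'I_(rk discl (range a) B)].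
  by rewrite size_map size_enum_ord.
apply: (steinitz cl_sub cl_trans cl_exchange ib) => i.
have : discl (A0 `|` B) (b i) by apply: aA0; exists (f i).
apply: cl_sub => x [|]; [rewrite -gA0 => -[k _ <-]; right|by left].
by apply/mapP; exists k; rewrite ?mem_enum.
Qed.
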